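(* Let $X\in\mathcal{T}(S)$ and let $\lambda\in\mathcal{ML}(S)$ be supported on a union of simple closed geodesics. Let $X(\lambda)\in P(X)$ be the projective structure on $X$ with grafting lamination $\lambda$, let $\phi_T(\lambda)\in Q(X)$ be the Schwarzian derivative of its developing map, let $\Phi(\lambda)$ be the grafting differential, let $\rho_0$ be the hyperbolic metric of $X$ and $\rho_\lambda$ the Thurston metric of $X(\lambda)$. Then $$2\phi_T(\lambda)=4\beta(\rho_0,\rho_\lambda)-\Phi(\lambda),$$ where $\beta(\rho_0,\rho_\lambda)$ is the Schwarzian tensor of $\rho_\lambda$ relative to $\rho_0$.
   Context: $S$ is a closed oriented smooth surface of genus $g\ge2$; $\mathcal{T}(S)$ is its Teichmüller space and $\mathcal{ML}(S)$ its space of measured geodesic laminations. $Q(X)$ is the space of holomorphic quadratic differentials on $X$. $P(X)$ is the set of marked $\mathbb{CP}^1$ structures (atlases with Möbius transition functions) on $S$ with underlying Riemann surface $X$. A structure in $P(X)$ has a developing map $f:\widetilde X\cong\mathbb{D}\to\mathbb{CP}^1$, whose Schwarzian derivative $S(f)=[(f''/f')'-\frac12(f''/f')^2]dz^2$ descends to an element of $Q(X)$. **Grafting.** For $\lambda=\sum_i t_i\gamma_i$ (disjoint simple closed geodesics with weights $t_i>0$) on a hyperbolic surface $Y$, the grafted surface $\mathrm{Gr}_\lambda Y$ is obtained by cutting $Y$ along each $\gamma_i$ and inserting, without twisting, the Euclidean cylinder $\gamma_i\times[0,t_i]$; the complement of the cylinders has the Fuchsian $\mathbb{CP}^1$ structure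 of $Y$, and when a lift of $\gamma_i$ is normalized to be a ray from $0$ to $\infty$, the cylinder has the $\mathbb{CP}^1$ structure of the quotient of an angular sector of angle $t_i$ with vertex $0$ (in the universal cover of $\mathbb{C}^*$ if $t_i\geq2\pi$) by $z\mapsto e^{\ell(\gamma_i,Y)}z$. Its underlying Riemann surface is denoted $\mathrm{gr}_\lambda Y$; $\mathrm{gr}_\lambda:\mathcal{T}(S)\to\mathcal{T}(S)$ is a homeomorphism. Put $Y_\lambda=\mathrm{gr}_\lambda^{-1}(X)$, $X(\lambda)=\mathrm{Gr}_\lambda Y_\lambda\in P(X)$ and $\phi_T(\lambda)=S(f_\lambda)$, with $f_\lambda$ the developing map of $X(\lambda)$. **Thurston metric.** $\rho_\lambda$ is the conformal metric on $X$ that equals the hyperbolic metric of $Y_\lambda$ on the part of $X(\lambda)$ coming from $Y_\lambda$ and the Euclidean product metric on the cylinders; equivalently, the length of $v\in T_xX$ is the minimum, over locally Möbius maps $\delta:\mathbb{D}\to X(\lambda)$ with $\delta(0)=x$, of the hyperbolic length of $v$ pulled back by $\delta$. Its density is $C^{1,1}$. $\rho_0$ is the hyperbolic metric (curvature $-1$) of $X$. **Grafting differential.** Let $\kappa:X\to Y_\lambda$ be the collapsing map, which is the identity on the part coming from $Y_\lambda$ and the projection $\gamma_i\times[0,t_i]\to\gamma_i$ on each cylinder. The Hopf differential $\Phi(\kappa)$ is the $(2,0)$ part of the pullback by $\kappa$ of the hyperbolic metric of $Y_\lambda$, and $\Phi(\lambda)=4\Phi(\kappa)$. **Schwarzian tensor.**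 For conformal metrics $\rho_i=e^{\sigma_i}|dz|$, $i=1,2$, with $\sigma=\log(\rho_2/\rho_1)$, $$\beta(\rho_1,\rho_2)=[\mathrm{Hess}_{\rho_1}(\sigma)-d\sigma\otimes d\sigma]^{2,0}=\left[(\sigma_2-\sigma_1)_{zz}-((\sigma_2)_z)^2+((\sigma_1)_z)^2\right]dz^2 .$$ The asserted equality is between measurable quadratic differentials on $X$, i.e. almost everywhere ($\beta(\rho_0,\rho_\lambda)$ and $\Phi(\lambda)$ are not holomorphic). *)

(* Defs.v *)
(* Surfaces are handled on their universal covers, identified with the unit
   disk: a tensor on X is the tensor on the disk to which it lifts, and a
   quadratic differential q(z) dz^2 is represented by its coefficient q. *)
From HB Require Import structures.
From mathcomp Require Import all_boot all_order all_algebra.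
From mathcomp Require Import all_classical all_reals all_analysis.
From mathcomp Require Export complex.
Set Implicit Arguments.
Unset Strict Implicit.
Unset Printing Implicit Defensive.
Import Order.TTheory GRing.Theory Num.Theory numFieldNormedType.Exports.
Local Open Scope classical_set_scope.
Local Open Scope ring_scope.
Local Open Scope complex_scope.

(* R[i] seen as a normed module over itself, so that [derivable f z 1] and
   [derive1 f z] are complex differentiability and the complex derivative. *)
Notation cplx R := (R[i]^o).
Notation cabs := ComplexField.Normc.normc.

Section ComplexAnalysis.
Variable R : realType.
Local Notation C := (cplx R).
Implicit Types (z w p : C) (f : C -> C).

Definition disk : set C := [set z | cabs z < 1].
Definition halfplane : set C := [set z | 0 < complex.Im z].

Definition cexp z : C :=
  (expR (complex.Re z))%:C * (cos (complex.Im z) +i* sin (complex.Im z)).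

Definition conformal_on (U : set C) f :=
  forall z, U z -> derivable f z 1 /\ derive1 f z != 0.

(* CP^1 is [option C], with [None] the point at infinity. *)
Definition mobius (M : 'M[C]_2) z : option C :=
  let d := M ord_max ord0 * z + M ord_max ord_max in
  if d == 0 then None else Some ((M ord0 ord0 * z + M ord0 ord_max) / d).

Definition mobius_on (U : set C) f :=
  exists2 M : 'M[C]_2, M \in unitmx & forall z, U z -> mobius M z = Some (f z).

Definition inv_cp1 (x : option C) : option C :=
  if x is Some y then (if y == 0 then None else Some y^-1) else Some 0.

Definition schwarz f z : C :=
  let q := fun w : C => derive1 (derive1 f : C -> C) w / derive1 f w in
  derive1 (q : C -> C) z - q z ^+ 2 / 2.

(* At a pole the Schwarzian derivative is that of 1/f. *)
Definition schwarzian (f : C -> option C) z : C :=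
  if f z is Some _ then schwarz (fun w => odflt 0 (f w)) z
  else schwarz (fun w => odflt 0 (inv_cp1 (f w))) z.

(* Real partial derivatives of a complex-valued function of z = x + iy. *)
Definition dx f z : C :=
  derive1 (fun h : R => complex.Re (f (z + h%:C))) 0
  +i* derive1 (fun h : R => complex.Im (f (z + h%:C))) 0.
Definition dy f z : C :=
  derive1 (fun h : R => complex.Re (f (z + h *i))) 0
  +i* derive1 (fun h : R => complex.Im (f (z + h *i))) 0.
Definition wirtinger f z : C := (dx f z - (0 +i* 1) * dy f z) / 2.

(* The density, with respect to |dz|, of the hyperbolic metric of curvature
   -1 on the disk. *)
Definition hyp_density z : R := 2 / (1 - cabs z ^+ 2).

(* The Schwarzian tensor of r2 |dz| relative to r1 |dz|. *)
Definition schwarzian_tensor (r1 r2 : C -> R) z : C :=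
  let s1 := fun w : C => (ln (r1 w))%:C : C in
  let s2 := fun w : C => (ln (r2 w))%:C : C in
  wirtinger (wirtinger (fun w => s2 w - s1 w)) z
  - wirtinger s2 z ^+ 2 + wirtinger s1 z ^+ 2.

(* (2,0) part of the symmetric form E dx^2 + 2 F dx dy + G dy^2. *)
Definition part20 (E F G : R) : C := ((E - G) / 4) +i* (- (F / 2)).

(* The (2,0) part of the pullback by k of the hyperbolic metric. *)
Definition hopf_differential (k : C -> C) z : C :=
  let r := hyp_density (k z) ^+ 2 in
  part20 (r * cabs (dx k z) ^+ 2)
         (r * complex.Re (dx k z * conjc (dy k z)))
         (r * cabs (dy k z) ^+ 2).

(* Null sets of X are those whose preimage in the disk is Lebesgue-null. *)
Definition qd_eq_ae (q1 q2 : C -> C) :=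
  {ae ((@lebesgue_measure R) \x (@lebesgue_measure R))%E,
    forall p : R * R, disk (p.1 +i* p.2) -> q1 (p.1 +i* p.2) = q2 (p.1 +i* p.2)}.

End ComplexAnalysis.

(* pi is the fundamental group of a closed oriented surface of genus g, i.e.
   the group with generators a_i, b_i and the relation prod_i [a_i, b_i] = 1,
   described by the universal property of the presentation. *)
Definition surface_group (g : nat) (pi : groupType) :=
  exists a b : 'I_g -> pi,
    (\prod_(i < g) [~ a i, b i] = 1)%g /\
    forall (G : groupType) (a' b' : 'I_g -> G),
      (\prod_(i < g) [~ a' i, b' i] = 1)%g ->
      exists! f : pi -> G,
        [/\ forall x y, (f (x * y) = f x * f y)%g,
            forall i, f (a i) = a' i & forall i, f (b i) = b' i].

(* Homotopy classes of curves (elements of the fundamental group), with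
   weights; no curve at all is allowed (the zero lamination). *)
Record weighted_curves (R : realType) (pi : groupType) := WeightedCurves {
  ncurves : nat;
  curve : 'I_ncurves -> pi;
  weight : 'I_ncurves -> R }.
Arguments curve {R pi} lam i : rename.
Arguments weight {R pi} lam i : rename.

Section Grafting.
Variables (R : realType) (pi : groupType).
Local Notation C := (cplx R).
Local Notation D := (@disk R).

(* A marked closed hyperbolic surface D / pi. A point of the Teichmueller
   space of a surface with fundamental group pi is the class of such an action
   up to conjugation by automorphisms of D. *)
Definition marked_surface (h : pi -> C -> C) :=
  [/\ forall a, mobius_on D (h a) /\ h a @` D = D,
      forall a b z, D z -> h (a * b)%g z = h a (h b z),
      forall z, D z -> exists2 U, nbhs z U &
        forall a, a != 1%g -> forall w, U w -> D w -> ~ U (h a w) &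
      exists2 r : R, r < 1 & forall z, D z -> exists a, cabs (h a z) <= r].

(* A maps the disk to the half-plane and the axis of c to the ray from 0 to
   infinity along the imaginary axis; l is then the translation length of c. *)
Definition normalizes (h : pi -> C -> C) (c : pi) (A : C -> C) :=
  [/\ mobius_on D A, A @` D = @halfplane R &
      exists2 l : R, 0 < l & forall z, D z -> A (h c z) = (expR l)%:C * A z].

Definition axis (h : pi -> C -> C) (c : pi) : set C :=
  [set p | D p /\ exists2 A, normalizes h c A & complex.Re (A p) = 0].

(* The curves are represented on D / h by disjoint simple closed geodesics:
   the geodesic of c is axis h c / <c>. *)
Definition multicurve_on (h : pi -> C -> C) (lam : weighted_curves R pi) :=
  [/\ forall i, 0 < weight lam i,
      forall i, curve lam i != 1%g,
      forall i a p, axis h (curve lam i) p -> axis h (curve lam i) (h a p) ->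
        exists n : nat, (a = curve lam i ^+ n)%g \/ (a = curve lam i ^- n)%g &
      forall i j a p, i != j ->
        axis h (curve lam i) p -> ~ axis h (curve lam j) (h a p)].

Variables (Y : pi -> C -> C) (lam : weighted_curves R pi).

(* The lifts to D of the i-th geodesic are the axes of the conjugates of the
   i-th curve. *)
Definition lam_lift (i : 'I_(ncurves lam)) (a : pi) : set C :=
  axis Y (curve lam i ^ a)%g.

Definition lam_support : set C := [set p | exists i a, lam_lift i a p].

(* The universal cover of Gr_lam Y, as a set: every point p of a lift of the
   i-th geodesic is replaced by the segment {p} x [0, t_i]. *)
Definition graft_cover : set (C * R) :=
  [set q | D q.1 /\
    ((~ lam_support q.1 /\ q.2 = 0) \/
     exists i a, lam_lift i a q.1 /\ 0 <= q.2 <= weight lam i)].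

(* Logarithmic coordinate (in the universal cover of C^* ) around an inserted
   strip of width t: once A has sent the lift to the ray of argument pi / 2,
   the side of argument < pi / 2 stays in place, the strip is the sector
   pi / 2 <= arg <= pi / 2 + t, and the other side is rotated by t. *)
Definition log_chart (A : C -> C) (t : R) (q : C * R) : C :=
  let z := A q.1 in
  ln (cabs z) +i* (acos (complex.Re z / cabs z) + q.2
                   + (if complex.Re z < 0 then t else 0)).

(* graft_chart U w e: on U, w is a conformal chart of Gr_lam Y and e \o w is
   locally a projective chart. These charts determine the topology, the complex
   structure and the projective structure of (the cover of) Gr_lam Y. *)
Inductive graft_chart : set (C * R) -> (C * R -> C) -> (C -> C) -> Prop :=
| complement_chart :
    graft_chart [set q | graft_cover q /\ ~ lam_support q.1] fst id
| cylinder_chart i a A : normalizes Y (curve lam i ^ a)%g A ->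
    graft_chart [set q | graft_cover q /\ (lam_support q.1 -> lam_lift i a q.1)]
      (log_chart A (weight lam i)) (@cexp R).

(* X = gr_lam Y: Psi lifts a conformal isomorphism from X to gr_lam Y
   compatible with the markings. *)
Definition graft_uniformization (X : pi -> C -> C) (Psi : C -> C * R) :=
  [/\ set_bij D graft_cover Psi,
      forall a z, D z -> Psi (X a z) = (Y a (Psi z).1, (Psi z).2) &
      forall U w e, graft_chart U w e ->
        open (D `&` Psi @^-1` U : set C) /\
        conformal_on (D `&` Psi @^-1` U) (w \o Psi)].

Variable Psi : C -> C * R.

(* f is a developing map of the projective structure on X transported from
   Gr_lam Y by Psi. *)
Definition developing_map (f : C -> option C) :=
  forall z, D z -> forall U w e, graft_chart U w e -> U (Psi z) ->
    exists2 M : 'M[C]_2, M \in unitmx &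
      \forall x \near z, f x = mobius M (e (w (Psi x))).

(* Lift of the map X -> Y collapsing the cylinders. *)
Definition collapsing_map (z : C) : C := (Psi z).1.

Definition grafting_differential (z : C) : C :=
  4 * hopf_differential collapsing_map z.

(* rho |dz| is the Thurston metric: the hyperbolic metric of Y on the part
   coming from Y, and the Euclidean metric |dw| on the cylinders. *)
Definition thurston_metric (rho : C -> R) :=
  forall z, D z ->
    (~ lam_support (collapsing_map z) ->
       rho z = hyp_density (collapsing_map z) * cabs (derive1 collapsing_map z))
    /\ forall i a A, normalizes Y (curve lam i ^ a)%g A ->
         lam_lift i a (collapsing_map z) ->
         rho z = cabs (derive1 (log_chart A (weight lam i) \o Psi : C -> C) z).

End Grafting.

(* Main.v *)
Require Import Defs.
From HB Require Import structures.
From mathcomp Require Import all_boot all_order all_algebra.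
From mathcomp Require Import all_classical all_reals all_analysis.
From mathcomp Require Import ring lra.
Import Order.TTheory GRing.Theory Num.Theory numFieldNormedType.Exports.
Local Open Scope classical_set_scope.
Local Open Scope ring_scope.
Set Implicit Arguments.
Unset Strict Implicit.
Unset Printing Implicit Defensive.
Local Open Scope complex_scope.

(** The three quadratic differentials are compared point by point. Let [kappa]
    be the collapsing map and [S] the Schwarzian derivative.

    The density [e^sigma] of the hyperbolic metric of the disk satisfies
    [sigma_zz = sigma_z^2]. Hence the tensor of a density [e^s] relative to it
    is just [s_zz - s_z^2] ([schwarzian_tensor_hyp]).

    Outside the inserted strips, [kappa] is conformal, so that its Hopf
    differential vanishes. The Thurston metric is the pullback by [kappa] of the
    hyperbolic metric, hence its tensor is [S(kappa) / 2]
    ([tensor_hyperbolic]), and the developing map is a Moebius map composed with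
    [kappa]. Both sides are thus [2 S(kappa)].

    Inside a strip there is a logarithmic coordinate [W] with
    [rho = |W'|], so the tensor is [S(W) / 2] ([tensor_euclidean]). The
    developing map is a Moebius map composed with [exp W], whose Schwarzian is
    [S(W) - W'^2 / 2]. The collapsing map depends on [Re W] only and
    parametrizes the geodesic by arc length, so four times its Hopf
    differential is [W'^2] ([hopf_strip]). Both sides are thus
    [2 S(W) - W'^2].

    The other points lie on the boundary of a strip. Locally [W] is defined
    across that boundary and sends it into finitely many horizontal lines.
    Since [W' <> 0], such a level set of [Im W] is null ([level_negligible]),
    and a set that is locally null is null ([locally_negligible]).

    Two points need work. First, the charts of the grafted surface are only
    known to be complex differentiable, while [S] takes three derivatives. So
    the derivative of a holomorphic function has to be shown to be holomorphic
    ([holomorphic_deriv]). Goursat's theorem, applied to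
    [(f (z + e^w) - f z) / e^w] on a rectangle of height [2 pi] whose left side
    goes to minus infinity, writes [f' z] as an average of values of [f] on a
    circle around [z] ([circle_derivative]). This average is continuous in [z],
    hence so is [f'], and then it can be differentiated under the integral.
    Secondly, a geodesic is described by any of its normalizations, a Moebius
    map from the disk onto the half-plane; that they all define the same points
    is seen from the displacement of the translation ([axis_normalizes]). *)

(** * The modulus and the topology of the complex plane *)

Section Modulus.
Variable R : realType.
Local Notation C := (cplx R).
Implicit Types (x y z w : C) (e : R).

Lemma normC_cabs z : `|z| = (cabs z)%:C :> R[i].
Proof. by []. Qed.

Lemma cabs_ge0 z : 0 <= cabs z.
Proof. by case: z => a b; rewrite sqrtr_ge0. Qed.

Lemma cabs0 : cabs (0 : C) = 0.
Proof. exact: ComplexField.Normc.normc0. Qed.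

Lemma cabsM x y : cabs (x * y) = cabs x * cabs y.
Proof. exact: ComplexField.Normc.normcM. Qed.

Lemma cabsV x : cabs x^-1 = (cabs x)^-1.
Proof. exact: ComplexField.Normc.normcV. Qed.

Lemma cabsN x : cabs (- x) = cabs x.
Proof. exact: (@normrN _ (Rcomplex R)). Qed.

Lemma ler_cabsD x y : cabs (x + y) <= cabs x + cabs y.
Proof. exact: (@ler_normD _ (Rcomplex R)). Qed.

Lemma ler_cabsB x y : cabs (x - y) <= cabs x + cabs y.
Proof. by rewrite -(cabsN y) ler_cabsD. Qed.

Lemma cabs_real (a : R) : cabs a%:C = `|a|.
Proof. by rewrite /cabs /= expr0n addr0 sqrtr_sqr. Qed.

Lemma cabs_sqr z : cabs z ^+ 2 = complex.Re z ^+ 2 + complex.Im z ^+ 2.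
Proof. by case: z => a b; rewrite sqr_sqrtr// addr_ge0// sqr_ge0. Qed.

Lemma cabs_eq0 z : (cabs z == 0) = (z == 0).
Proof.
apply/eqP/eqP => [|->]; first exact: ComplexField.Normc.eq0_normc.
by rewrite ComplexField.Normc.normc0.
Qed.

Lemma cabs_gt0 z : (0 < cabs z) = (z != 0).
Proof. by rewrite lt_neqAle cabs_ge0 andbT eq_sym cabs_eq0. Qed.

Lemma cabs_le_ReIm (z : C) : cabs z <= `|complex.Re z| + `|complex.Im z|.
Proof.
case: z => x y /=; rewrite -(@ler_pXn2r _ 2)// ?nnegrE ?sqrtr_ge0 ?addr_ge0//.
rewrite sqr_sqrtr ?addr_ge0 ?sqr_ge0// sqrrD !real_normK ?num_real//.
by rewrite lerD2r lerDl mulrn_wge0// mulr_ge0.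
Qed.

Lemma Re_le_cabs (z : C) : `|complex.Re z| <= cabs z.
Proof.
case: z => x y /=; rewrite -(@ler_pXn2r _ 2)// ?nnegrE ?sqrtr_ge0//.
by rewrite sqr_sqrtr ?addr_ge0 ?sqr_ge0// real_normK ?num_real// lerDl sqr_ge0.
Qed.

Lemma Im_le_cabs (z : C) : `|complex.Im z| <= cabs z.
Proof.
case: z => x y /=; rewrite -(@ler_pXn2r _ 2)// ?nnegrE ?sqrtr_ge0//.
by rewrite sqr_sqrtr ?addr_ge0 ?sqr_ge0// real_normK ?num_real// lerDr sqr_ge0.
Qed.

(** Balls in [R[i]] have radii in [R[i]], but a positive complex number is real,
    so radii in [R] suffice. *)
Lemma nbhs_cabsP z (P : set C) :
  nbhs z P <-> exists2 e, 0 < e & forall w, cabs (w - z) < e -> P w.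
Proof.
split.
  move/nbhs_ballP => -[e /= e0 He].
  case: e e0 He => e1 e2; rewrite ltcE /= => /andP[/eqP-> e0 He].
  exists e1 => // w we; apply: He; rewrite -ball_normE /=.
  by rewrite distrC normC_cabs ltcR.
case=> e e0 He; apply/nbhs_ballP; exists e%:C => /=; first by rewrite ltcR.
move=> w; rewrite -ball_normE /= => wz; apply: He; move: wz.
by rewrite distrC normC_cabs ltcR.
Qed.

Lemma continuous_cabsP (q : C -> C) z : {for z, continuous q} <->
  forall e, 0 < e -> exists2 d, 0 < d & forall w, cabs (w - z) < d -> cabs (q w - q z) < e.
Proof.
split => [cq e e0|H].
  have : nbhs (q z) [set x | cabs (x - q z) < e] by apply/nbhs_cabsP; exists e.
  by move/cq => /nbhs_cabsP.
by move=> P /nbhs_cabsP[e /H[d d0 Hd] He]; apply/nbhs_cabsP; exists d => // w /Hd /He.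
Qed.

Lemma ccont_cst (c : C) z : {for z, continuous (fun=> c : C)}.
Proof.
by apply/continuous_cabsP => e e0; exists 1 => // w _; rewrite subrr cabs0.
Qed.

Lemma ccont_id z : {for z, continuous (fun w : C => w)}.
Proof. by move=> P. Qed.

Lemma ccontD (p q : C -> C) z : {for z, continuous p} -> {for z, continuous q} ->
  {for z, continuous (fun w => p w + q w)}.
Proof. by move=> cp cq; exact: (cvgD cp cq). Qed.

Lemma ccontN (p : C -> C) z : {for z, continuous p} -> {for z, continuous (fun w => - p w)}.
Proof.
move=> /continuous_cabsP cp; apply/continuous_cabsP => e /cp[d d0 Hd].
by exists d => // w /Hd; rewrite -opprD cabsN.
Qed.

Lemma ccontM (p q : C -> C) z : {for z, continuous p} -> {for z, continuous q} ->
  {for z, continuous (fun w => p w * q w)}.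
Proof. by move=> cp cq; exact: (cvgM cp cq). Qed.

Lemma ccontV (p : C -> C) z : p z != 0 -> {for z, continuous p} ->
  {for z, continuous (fun w => (p w)^-1)}.
Proof. by move=> pz cp; exact: (cvgV pz cp). Qed.

End Modulus.
Arguments ccont_cst {R} c z.
Arguments ccont_id {R} z.

(** * Complex derivatives *)

Section Derive.
Variable R : realType.
Local Notation C := (cplx R).
Local Notation K := (R[i] : numFieldType).
Implicit Types (x y z w d : C) (f g : C -> C).

(** Caratheodory's form of the derivative: the difference quotient extends
    continuously to [z]. The rules of calculus then reduce to algebra and to the
    continuity of products and composites. The quotient matters only near [z],
    so that the notion depends on the germ of [f] alone. *)
Definition is_cderive f z d := exists2 q : C -> C, {for z, continuous q} &
  (\forall w \near z, f w - f z = q w * (w - z)) /\ q z = d.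

Lemma is_cderive_near f g z d :
  (\forall w \near z, f w = g w) -> is_cderive f z d -> is_cderive g z d.
Proof.
move=> fg [q cq [fq qd]]; exists q => //; split => //.
have fgz : f z = g z := nbhs_singleton fg.
by apply: filterS2 fg fq => w -> ; rewrite fgz.
Qed.

Lemma is_cderiveP f z d : is_cderive f z d <-> derivable f z 1 /\ derive1 f z = d.
Proof.
split.
  case=> q cq [/nbhs_cabsP[r r0 fq] <-].
  have H : (fun h : R[i] => h^-1 *: ((f \o shift z) (h *: (1:C)) - f z)) @ (0 : K)^' --> q z.
    move=> P /cq /nbhs_cabsP[e e0 He].
    rewrite /nbhs /= /within /=; apply/nbhs_cabsP.
    exists (Order.min e r); first by rewrite lt_min e0 r0.
    move=> h; rewrite subr0 lt_min => /andP[he hr] h0 /=.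
    have E : h *: (1:C) + z = h + z by rewrite [h *: _]mulr1.
    rewrite E fq ?addrK//.
    rewrite [_ *: _]mulrC -mulrA divff// mulr1.
    by apply: He; rewrite addrK.
  split; first by apply/cvg_ex; exists (q z).
  by rewrite derive1E; exact: (cvg_lim _ H).
case=> df <-; rewrite derive1E.
set d0 := 'D_1 f z.
have H : (fun h : R[i] => h^-1 *: ((f \o shift z) (h *: (1:C)) - f z)) @ (0 : K)^' --> d0.
  exact: df.
pose q w : C := if w == z then d0 else (f w - f z) / (w - z).
exists q; last first.
  split; last by rewrite /q eqxx.
  near=> w; rewrite /q; case: eqP => [->|/eqP wz]; first by rewrite !subrr mulr0.
  by rewrite mulfVK// subr_eq0.
move=> P; rewrite {1}/q eqxx => d0P.
have /nbhs_cabsP[e e0 He] := H _ d0P.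
apply/nbhs_cabsP; exists e => // w we /=; rewrite /q.
case: eqP => [_|/eqP wz]; first exact: nbhs_singleton d0P.
have := He (w - z); rewrite subr0 => /(_ we); rewrite subr_eq0 => /(_ wz) /=.
have -> : (w - z) *: (1:C) + z = w by rewrite [_ *: _]mulr1 subrK.
by rewrite [_ *: _]mulrC.
Unshelve. all: by end_near.
Qed.

(** The remainder estimate that the proof of Goursat's theorem consumes. *)
Lemma is_cderive_eps f z d : is_cderive f z d ->
  forall e : R, 0 < e -> exists2 r : R, 0 < r & forall w, cabs (w - z) < r ->
    cabs (f w - f z - d * (w - z)) <= e * cabs (w - z).
Proof.
case=> q /continuous_cabsP cq [/nbhs_cabsP[r r0 fq] <-] e e0.
have [r' r'0 Hr'] := cq _ e0.
exists (Order.min r r'); first by rewrite lt_min r0.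
move=> w; rewrite lt_min => /andP[wr wr'].
rewrite fq// -mulrBl ComplexField.Normc.normcM.
by apply: ler_wpM2r; [exact: cabs_ge0|exact/ltW/Hr'].
Qed.

Lemma eps_is_cderive f z d :
  (forall e : R, 0 < e -> exists2 r : R, 0 < r & forall w, cabs (w - z) < r ->
    cabs (f w - f z - d * (w - z)) <= e * cabs (w - z)) -> is_cderive f z d.
Proof.
move=> H; pose q w : C := if w == z then d else (f w - f z) / (w - z).
exists q; last first.
  split; last by rewrite /q eqxx.
  near=> w; rewrite /q; case: eqP => [->|/eqP wz]; first by rewrite !subrr mulr0.
  by rewrite mulfVK// subr_eq0.
apply/continuous_cabsP => e e0.
have e20 : 0 < e / 2 by rewrite divr_gt0.
have [r r0 Hr] := H _ e20; exists r => // w wr; rewrite /q eqxx.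
case: eqP => [_|/eqP wz]; first by rewrite subrr cabs0.
have wz0 : w - z != 0 by rewrite subr_eq0.
have := Hr w wr.
have -> : f w - f z - d * (w - z) = ((f w - f z) / (w - z) - d) * (w - z).
  by rewrite mulrBl mulfVK.
rewrite cabsM ler_pM2r ?cabs_gt0//.
by move/le_lt_trans; apply; rewrite gtr_pMr// invf_lt1// ltr1n.
Unshelve. all: by end_near.
Qed.

Lemma is_cderive_continuous f z d : is_cderive f z d -> {for z, continuous f}.
Proof.
case=> q cq [fq qd].
have H : {for z, continuous (fun w => q w * (w - z) + f z)}.
  apply: ccontD; last exact: ccont_cst.
  exact: (ccontM cq (ccontD (ccont_id z) (ccont_cst (- z) z))).
move=> P fP; have := H P; rewrite subrr mulr0 add0r => /(_ fP) HP.
have {}HP : \forall w \near z, P (q w * (w - z) + f z) := HP.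
have : \forall w \near z, P (f w).
  by apply: filterS2 fq HP => w E; rewrite -E subrK.
by [].
Qed.

Lemma is_cderive_cst (c : C) z : is_cderive (fun=> c) z 0.
Proof.
exists (fun=> 0); first exact: ccont_cst.
by split => //; apply: filterE => w; rewrite subrr mul0r.
Qed.

Lemma is_cderive_id z : is_cderive id z 1.
Proof.
exists (fun=> 1); first exact: ccont_cst.
by split => //; apply: filterE => w; rewrite mul1r.
Qed.

Lemma is_cderiveD f g z a b : is_cderive f z a -> is_cderive g z b ->
  is_cderive (fun w => f w + g w) z (a + b).
Proof.
move=> [p cp [fp <-]] [q cq [gq <-]]; exists (fun w => p w + q w).
  exact: ccontD.
split => //; apply: filterS2 fp gq => w Hp Hq.
by rewrite mulrDl -Hp -Hq; ring.
Qed.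

Lemma is_cderiveM f g z a b : is_cderive f z a -> is_cderive g z b ->
  is_cderive (fun w => f w * g w) z (a * g z + f z * b).
Proof.
move=> Hf [q cq [gq <-]]; have cf := is_cderive_continuous Hf.
case: Hf => p cp [fp <-]; exists (fun w => p w * g z + f w * q w).
  exact: (ccontD (ccontM cp (ccont_cst (g z) z)) (ccontM cf cq)).
split => //; apply: filterS2 fp gq => w Hp Hq.
rewrite mulrDl -mulrA [g z * _]mulrC mulrA -Hp -mulrA -Hq; ring.
Qed.

Lemma is_cderiveZ (c : C) f z a : is_cderive f z a -> is_cderive (fun w => c * f w) z (c * a).
Proof.
by move=> Hf; have := is_cderiveM (is_cderive_cst c z) Hf; rewrite mul0r add0r.
Qed.

Lemma is_cderiveN f z a : is_cderive f z a -> is_cderive (fun w => - f w) z (- a).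
Proof.
move=> /(is_cderiveZ (-1)); rewrite mulN1r; apply: is_cderive_near.
by apply: filterE => w; rewrite mulN1r.
Qed.

Lemma is_cderiveB f g z a b : is_cderive f z a -> is_cderive g z b ->
  is_cderive (fun w => f w - g w) z (a - b).
Proof. by move=> Hf /is_cderiveN; exact: is_cderiveD. Qed.

Lemma continuous_neq0 f z : {for z, continuous f} -> f z != 0 ->
  \forall w \near z, f w != 0.
Proof.
move=> /continuous_cabsP cf fz; apply/nbhs_cabsP.
have fz0 : 0 < cabs (f z) by rewrite cabs_gt0.
have [d d0 Hd] := cf _ fz0.
exists d => // w /Hd; apply: contraTN => /eqP ->.
by rewrite sub0r cabsN ltxx.
Qed.

Lemma is_cderiveV f z a : f z != 0 -> is_cderive f z a ->
  is_cderive (fun w => (f w)^-1) z (- a / f z ^+ 2).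
Proof.
move=> fz0 Hf; have cf := is_cderive_continuous Hf.
case: Hf => p cp [fp <-]; exists (fun w => - p w / (f w * f z)); last first.
  split => //; apply: filterS2 fp (continuous_neq0 cf fz0) => w Hp fw.
  rewrite mulrAC mulNr -Hp; field; by rewrite fw fz0.
have nz : f z * f z != 0 by rewrite mulf_neq0.
exact: (ccontM (ccontN cp) (@ccontV _ (fun w => f w * f z) z nz (ccontM cf (ccont_cst (f z) z)))).
Qed.

Lemma is_cderive_comp f g z a b : is_cderive f z a -> is_cderive g (f z) b ->
  is_cderive (g \o f) z (b * a).
Proof.
move=> Hf [q cq [gq <-]]; have cf := is_cderive_continuous Hf.
case: Hf => p cp [fp <-]; exists (fun w => q (f w) * p w).
  exact: (ccontM (continuous_comp cf cq) cp).
split => //; have := cf _ gq; rewrite /= => gq'.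
apply: filterS2 fp gq' => w Hp /= ->; by rewrite Hp mulrA.
Qed.

End Derive.

(** * Integrals of complex-valued functions of a real variable *)

Section Integral.
Variable R : realType.
Local Notation C := (cplx R).
Local Notation mu := (@lebesgue_measure R).
Implicit Types (a b m M : R) (F G : R -> C).

(** Continuity of both components, the form in which integrability is obtained
    for [cint]. *)
Definition rcont F a := {for a, continuous (fun x => complex.Re (F x))} /\
  {for a, continuous (fun x => complex.Im (F x))}.

Lemma rcontP F a : rcont F a <-> forall e : R, 0 < e -> exists2 d, 0 < d &
  forall x, `|x - a| < d -> cabs (F x - F a) < e.
Proof.
split.
  move=> [/cvgrPdist_lt HR /cvgrPdist_lt HI] e e0.
  have e20 : 0 < e / 2 by rewrite divr_gt0.
  have /nbhs_ballP[d1 /= d10 H1] := HR _ e20.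
  have /nbhs_ballP[d2 /= d20 H2] := HI _ e20.
  exists (Order.min d1 d2); first by rewrite lt_min d10.
  move=> x; rewrite lt_min distrC => /andP[x1 x2].
  rewrite (splitr e) (le_lt_trans (cabs_le_ReIm _))// ltrD//.
    by have := H1 _ x1; rewrite distrC !raddfB.
  by have := H2 _ x2; rewrite distrC !raddfB.
move=> H; split; apply/cvgrPdist_lt => e /H[d d0 Hd];
  apply/nbhs_ballP; exists d => // x; rewrite /ball /= distrC => /Hd;
  rewrite distrC -raddfB; apply: le_lt_trans; [exact: Re_le_cabs|exact: Im_le_cabs].
Qed.

Lemma rcontD F G a : rcont F a -> rcont G a -> rcont (fun x => F x + G x) a.
Proof.
move=> /rcontP HF /rcontP HG; apply/rcontP => e e0.
have e20 : 0 < e / 2 by rewrite divr_gt0.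
have [[d1 d10 H1] [d2 d20 H2]] := (HF _ e20, HG _ e20).
exists (Order.min d1 d2); first by rewrite lt_min d10.
move=> x; rewrite lt_min => /andP[/H1 h1 /H2 h2].
by rewrite opprD addrACA (splitr e) (le_lt_trans (ler_cabsD _ _))// ltrD.
Qed.

Lemma rcont_cst (c : C) a : rcont (fun=> c) a.
Proof. by split; exact: cvg_cst. Qed.

Lemma rcontN F a : rcont F a -> rcont (fun x => - F x) a.
Proof.
by move=> /rcontP H; apply/rcontP => e /H[d d0 Hd]; exists d => // x /Hd; rewrite -opprD cabsN.
Qed.

Lemma rcont_comp (f : C -> C) F a :
  rcont F a -> {for (F a), continuous f} -> rcont (f \o F) a.
Proof.
move=> /rcontP HF /continuous_cabsP Hf; apply/rcontP => e /Hf[d /HF[r r0 Hr] Hd].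
by exists r => // x /Hr /Hd.
Qed.

Definition cint a b F : C :=
  (\int[mu]_(x in `[a, b]) complex.Re (F x))%R +i*
  (\int[mu]_(x in `[a, b]) complex.Im (F x))%R.

Definition rcont_on a b F := forall x, a <= x <= b -> rcont F x.

Let itgR a b (h : R -> R) : (forall x, a <= x <= b -> {for x, continuous h}) ->
  mu.-integrable `[a, b] (EFin \o h).
Proof.
move=> ch; apply: continuous_compact_integrable; first exact: segment_compact.
apply: continuous_in_subspaceT => x; rewrite inE /= in_itv /=; exact: ch.
Qed.

Lemma cintD a b F G : rcont_on a b F -> rcont_on a b G ->
  cint a b (fun x => F x + G x) = cint a b F + cint a b G.
Proof.
move=> cF cG; rewrite /cint; apply/eqP; rewrite eq_complex /=; apply/andP; split; apply/eqP.
  under eq_Rintegral do rewrite raddfD.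
  by rewrite RintegralD//; apply: itgR => x xab; [exact: (cF x xab).1|exact: (cG x xab).1].
under eq_Rintegral do rewrite raddfD.
by rewrite RintegralD//; apply: itgR => x xab; [exact: (cF x xab).2|exact: (cG x xab).2].
Qed.

Lemma eq_cint a b F G : (forall x, a <= x <= b -> F x = G x) -> cint a b F = cint a b G.
Proof.
by move=> FG; rewrite /cint; congr (_ +i* _); apply: eq_Rintegral => x;
  rewrite inE /= in_itv /= => /FG ->.
Qed.

Let mu_itv a b : a <= b -> fine (mu `[a, b]) = b - a.
Proof.
rewrite lebesgue_measure_itv /= lte_fin le_eqVlt => /predU1P[->|->//].
by rewrite ltxx subrr.
Qed.

Lemma cint_cst a b (c : C) : a <= b -> cint a b (fun=> c) = (b - a)%:C * c.
Proof.
move=> ab; rewrite /cint !Rintegral_cst//= mu_itv//.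
by case: c => x y /=; rewrite mulrC; apply/eqP; rewrite eq_complex /= !mul0r subr0 addr0 eqxx mulrC/= eqxx.
Qed.

Lemma cint_cat a m b F : a <= m <= b -> rcont_on a b F ->
  cint a b F = cint a m F + cint m b F.
Proof.
move=> /andP[am mb] cF; rewrite /cint; apply/eqP; rewrite eq_complex /=.
have E (h : R -> R) : (forall x, a <= x <= b -> {for x, continuous h}) ->
    \int[mu]_(x in `[a, b]) h x = \int[mu]_(x in `[a, m]) h x + \int[mu]_(x in `[m, b]) h x.
  move=> ch.
  have -> : `[a, b]%classic = `[a, m[ `|` `[m, b].
    by rewrite -[RHS](@itv_bndbnd_setU _ _ _ (BLeft m))// bnd_simp.
  rewrite Rintegral_setU//=.
  - rewrite Rintegral_itv_bndo_bndc//; apply: integrableS (itgR ch) => //.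
    by apply: subset_itvl; rewrite bnd_simp.
  - rewrite -(@itv_bndbnd_setU _ _ _ (BLeft m)) ?bnd_simp//; exact: itgR.
  - apply/disj_setPLR => x /=; rewrite !in_itv/= => /andP[_ xm] /andP[mx _].
    by move: (lt_le_trans xm mx); rewrite ltxx.
by rewrite !E ?eqxx// => x /cF[].
Qed.

(** Estimating the two components separately costs a factor 2, which is
    harmless where the bound tends to [0]. *)
Lemma cint_norm a b F M : a <= b -> rcont_on a b F ->
  (forall x, a <= x <= b -> cabs (F x) <= M) -> cabs (cint a b F) <= 2 * M * (b - a).
Proof.
move=> ab cF FM.
have E (h : R -> R) : (forall x, a <= x <= b -> {for x, continuous h}) ->
    (forall x, a <= x <= b -> `|h x| <= M) ->
    `|\int[mu]_(x in `[a, b]) h x| <= M * (b - a).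
  move=> ch hM; have ih := itgR ch.
  apply: (le_trans (le_normr_Rintegral _ ih)) => //.
  rewrite -(mu_itv ab) -(@Rintegral_cst _ _ _ mu)//.
  apply: le_Rintegral => //.
  - by have := integrable_norm ih.
  - by apply: itgR => x _; exact: cvg_cst.
apply: (le_trans (cabs_le_ReIm _)) => /=.
rewrite -mulrA mulr_natl mulr2n; apply: lerD; apply: E => x xab.
- exact: (cF x xab).1.
- exact: (le_trans (Re_le_cabs _) (FM x xab)).
- exact: (cF x xab).2.
- exact: (le_trans (Im_le_cabs _) (FM x xab)).
Qed.

Lemma cintZ (a b : R) (c : C) (F : R -> C) : rcont_on a b F ->
  cint a b (fun x => c * F x) = c * cint a b F.
Proof.
move=> cF; case: c => p q.
have iR : mu.-integrable `[a, b] (EFin \o (fun x => complex.Re (F x))).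
  by apply: itgR => x /cF[].
have iI : mu.-integrable `[a, b] (EFin \o (fun x => complex.Im (F x))).
  by apply: itgR => x /cF[].
have iZ (k : R) (g : R -> R) : mu.-integrable `[a, b] (EFin \o g) ->
    mu.-integrable `[a, b] (EFin \o (fun x => k * g x)).
  by move=> ig; have := integrableZl _ k ig; apply.
rewrite /cint; apply/eqP; rewrite eq_complex /=; apply/andP; split; apply/eqP.
  rewrite -!RintegralZl// -RintegralB//; [|exact: iZ|exact: iZ].
  by apply: eq_Rintegral => x _; case: (F x).
rewrite -!RintegralZl// -RintegralD//; [|exact: iZ|exact: iZ].
by apply: eq_Rintegral => x _; case: (F x).
Qed.

End Integral.

(** * Goursat's theorem for rectangles *)

Section Goursat.
Variable R : realType.
Local Notation C := (cplx R).
Implicit Types (a b c d : R).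

Lemma half_pow_lt (L e : R) : 0 <= L -> 0 < e -> exists n, L / 2 ^+ n < e.
Proof.
move=> L0 e0; have Le : 0 <= L / e by rewrite divr_ge0// ltW.
exists (Num.bound (L / e)); rewrite ltr_pdivrMr ?exprn_gt0// mulrC -ltr_pdivrMr//.
apply: (lt_trans (archi_boundP Le)).
by rewrite -natrX ltr_nat ltn_expl.
Qed.

(** If [B] did not vanish on the whole rectangle, one of the four quarters
    would carry at least a quarter of its value. Repeating this gives nested
    rectangles on which [B] decays no faster than their area; at their common
    point this contradicts the local estimate. *)
Lemma bisection (B : R -> R -> R -> R -> C) a b c d : a <= b -> c <= d ->
  (forall a' b' c' d', a <= a' -> a' <= b' -> b' <= b -> c <= c' -> c' <= d' -> d' <= d ->
    let m := (a' + b') / 2 in let n := (c' + d') / 2 in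
    B a' b' c' d' = B a' m c' n + B m b' c' n + B a' m n d' + B m b' n d') ->
  (forall x y, a <= x <= b -> c <= y <= d -> forall e, 0 < e -> exists2 r, 0 < r &
    forall a' b' c' d', a <= a' <= x -> x <= b' <= b -> c <= c' <= y -> y <= d' <= d ->
      (b' - a') + (d' - c') < r ->
      cabs (B a' b' c' d') <= e * ((b' - a') + (d' - c')) ^+ 2) ->
  B a b c d = 0.
Proof.
move=> ab cd add loc; apply/eqP; rewrite -cabs_eq0; apply/contraT.
move=> Bn0; have B0 : 0 < cabs (B a b c d) by rewrite lt_neqAle eq_sym Bn0 cabs_ge0.
set eta := cabs (B a b c d) in B0 *.
set w := b - a; set v := d - c.
have w0 : 0 <= w by rewrite subr_ge0.
have v0 : 0 <= v by rewrite subr_ge0.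
(* After n steps a rectangle is known by its lower left corner: its sides
   are those of the initial one divided by 2 ^ n. *)
pose h n (s : R) := s / 2 ^+ n.
have hS n s : h n s = 2 * h n.+1 s.
  by rewrite /h exprS; field; rewrite expf_neq0.
have h0 n s : 0 <= s -> 0 <= h n s by move=> s0; rewrite divr_ge0// exprn_ge0.
pose ok n (p : R * R) := [/\ a <= p.1, p.1 + h n w <= b, c <= p.2, p.2 + h n v <= d &
  eta / 4 ^+ n <= cabs (B p.1 (p.1 + h n w) p.2 (p.2 + h n v))].
pose next n (p q : R * R) := [/\ ok n.+1 q, p.1 <= q.1, q.1 + h n.+1 w <= p.1 + h n w,
  p.2 <= q.2 & q.2 + h n.+1 v <= p.2 + h n v].
have step n p : ok n p -> exists q, next n p q.
  case=> ap pb cp pd He.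
  have w1 := h0 n.+1 _ w0; have v1 := h0 n.+1 _ v0.
  have := add p.1 (p.1 + h n w) p.2 (p.2 + h n v) ap _ pb cp _ pd.
  rewrite !lerDl !h0// => /(_ isT isT) /=.
  have -> : (p.1 + (p.1 + h n w)) / 2 = p.1 + h n.+1 w by rewrite (hS n w); field.
  have -> : (p.2 + (p.2 + h n v)) / 2 = p.2 + h n.+1 v by rewrite (hS n v); field.
  move=> E; move: He; rewrite E.
  set B1 := B p.1 (p.1 + h n.+1 w) p.2 (p.2 + h n.+1 v).
  set B2 := B (p.1 + h n.+1 w) (p.1 + h n w) p.2 (p.2 + h n.+1 v).
  set B3 := B p.1 (p.1 + h n.+1 w) (p.2 + h n.+1 v) (p.2 + h n v).
  set B4 := B (p.1 + h n.+1 w) (p.1 + h n w) (p.2 + h n.+1 v) (p.2 + h n v).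
  move=> He.
  have {}He : eta / 4 ^+ n <= cabs B1 + cabs B2 + cabs B3 + cabs B4.
    apply: (le_trans He); apply: (le_trans (ler_cabsD _ _)); rewrite lerD2r.
    by apply: (le_trans (ler_cabsD _ _)); rewrite lerD2r ler_cabsD.
  have e4 : eta / 4 ^+ n = 4 * (eta / 4 ^+ n.+1).
    by rewrite exprS; field; rewrite expf_neq0.
  have E2 (x s : R) : x + h n s = x + h n.+1 s + h n.+1 s by rewrite (hS n s); ring.
  rewrite e4 in He; set t := eta / _ in He.
  have [H1|H1] := leP t (cabs B1).
    exists p; split; rewrite ?lexx//; rewrite ?E2 ?lerDl//.
    by split => //; move: pb pd; rewrite !E2; lra.
  have [H2|H2] := leP t (cabs B2).
    exists (p.1 + h n.+1 w, p.2) => /=; split => /=; rewrite ?lexx// ?E2 ?lerDl ?lexx//.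
    split => /=; rewrite -?E2//; last by move: pd; rewrite E2; lra.
    by lra.
  have [H3|H3] := leP t (cabs B3).
    exists (p.1, p.2 + h n.+1 v) => /=; split => /=; rewrite ?lexx// ?E2 ?lerDl ?lexx//.
    split => /=; rewrite -?E2//; last by lra.
    by move: pb; rewrite E2; lra.
  exists (p.1 + h n.+1 w, p.2 + h n.+1 v) => /=; split => /=; rewrite ?lexx// ?E2 ?lerDl ?lexx//.
  split => /=; rewrite -?E2//; [lra|lra|].
  by move: He H1 H2 H3; rewrite -/t -/B4; lra.
pose nx n p := xget p [set q | next n p q].
pose s := fix s n := if n is k.+1 then nx k (s k) else (a, c).
have oks n : ok n (s n) /\ next n (s n) (s n.+1).
  suff : ok n (s n).
    move=> okn; split => //; have [q Hq] := step n _ okn.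
    by rewrite /= /nx; case: xgetP => [y _ []//|/(_ q)].
  elim: n => [|n IH].
    by split; rewrite /= /h ?expr0 ?divr1 ?lexx// /w /v ?subrKC// !(addrC _ (_ - _)) !subrK ?lexx.
  have [q Hq] := step n _ IH.
  by rewrite /= /nx; case: xgetP => [y _ []//|/(_ q)].
have lim (pr : R * R -> R) (z : R) : 0 <= z -> (forall n, pr (s n) <= pr (s n.+1)) ->
    (forall n, pr (s n.+1) + h n.+1 z <= pr (s n) + h n z) ->
    exists x, forall n, pr (s n) <= x <= pr (s n) + h n z.
  move=> z0 inc dec.
  have inc' m n : (m <= n)%N -> pr (s m) <= pr (s n).
    elim: n => [|n IH]; first by rewrite leqn0 => /eqP->.
    by rewrite leq_eqVlt => /predU1P[->//|/IH/le_trans]; apply.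
  have dec' m n : (m <= n)%N -> pr (s n) + h n z <= pr (s m) + h m z.
    elim: n => [|n IH]; first by rewrite leqn0 => /eqP->.
    rewrite leq_eqVlt => /predU1P[->//|/IH H].
    exact: le_trans (dec n) H.
  have ub m n : pr (s n) <= pr (s m) + h m z.
    have [mn|/ltnW nm] := leqP m n.
      by apply: le_trans (dec' _ _ mn); rewrite lerDl h0.
    by apply: (le_trans (inc' _ _ nm)); rewrite lerDl h0.
  pose S := [set pr (s n) | n in setT].
  have S0 : S !=set0 by exists (pr (s 0%N)); exists 0%N.
  exists (sup S) => n; apply/andP; split.
    apply: ub_le_sup; last by exists n.
    by exists (pr (s 0%N) + h 0%N z) => _ [m _ <-].
  by apply: ge_sup => // _ [m _ <-].
have [||x Hx] := lim fst w w0.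
- by move=> n; have [_ []] := oks n.
- by move=> n; have [_ []] := oks n.
have [||y Hy] := lim snd v v0.
- by move=> n; have [_ []] := oks n.
- by move=> n; have [_ []] := oks n.
have H0 : s 0%N = (a, c) by [].
have xab : a <= x <= b by have := Hx 0%N; rewrite H0 /h expr0 divr1 /w /= addrC subrK.
have ycd : c <= y <= d by have := Hy 0%N; rewrite H0 /h expr0 divr1 /v /= addrC subrK.
set L := w + v; have L0 : 0 <= L by rewrite addr_ge0.
(* With this e the local bound e L^2 / 4^n is below eta / 4^n. *)
pose e := eta / (2 * (L ^+ 2 + 1)).
have K0 : 0 < 2 * (L ^+ 2 + 1) by rewrite mulr_gt0// ltr_wpDl// sqr_ge0.
have e0 : 0 < e by rewrite divr_gt0.
have [r r0 Hr] := loc x y xab ycd e e0.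
have [n Ln] := half_pow_lt L0 r0.
have [[s1 s2 s3 s4 s5] _] := oks n.
have /andP[x1 x2] := Hx n; have /andP[y1 y2] := Hy n.
have := Hr (s n).1 ((s n).1 + h n w) (s n).2 ((s n).2 + h n v).
rewrite s1 x1 x2 s2 s3 y1 y2 s4 => /(_ isT isT isT isT).
have -> : (s n).1 + h n w - (s n).1 + ((s n).2 + h n v - (s n).2) = L / 2 ^+ n.
  by rewrite /L mulrDl -/(h n w) -/(h n v); ring.
move=> /(_ Ln) /(le_trans s5).
have p4 : 4 ^+ n = (2 ^+ n) ^+ 2 :> R.
  by rewrite -exprM mulnC exprM; congr (_ ^+ _); ring.
rewrite expr_div_n -p4 mulrA ler_pM2r ?invr_gt0 ?exprn_gt0//.
rewrite /e mulrAC ler_pdivlMr//; rewrite ler_pM2l//.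
by have := sqr_ge0 L; lra.
Qed.

End Goursat.

Section GoursatRect.
Variable R : realType.
Local Notation C := (cplx R).
Implicit Types (a b c d : R) (g : C -> C).

(** The integral of [g dz] along the boundary of a rectangle. Opposite sides are
    paired under one integral sign, which makes the integrand constant when [g]
    is affine. *)
Definition rect_int g a b c d : C :=
  cint a b (fun x => g (x +i* c) - g (x +i* d)) +
  (0 +i* 1) * cint c d (fun y => g (b +i* y) - g (a +i* y)).

Lemma rcont_horiz c a : rcont (fun x : R => x +i* c) a.
Proof. by split; [exact: cvg_id|exact: cvg_cst]. Qed.

Lemma rcont_vert c a : rcont (fun y : R => c +i* y) a.
Proof. by split; [exact: cvg_cst|exact: cvg_id]. Qed.

Lemma rcontB (F G : R -> C) a : rcont F a -> rcont G a -> rcont (fun x => F x - G x) a.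
Proof. by move=> cF /rcontN; exact: rcontD. Qed.

Let rcont_h g a b c d x : (forall x y, a <= x <= b -> c <= y <= d -> {for (x +i* y), continuous g}) ->
  a <= x <= b -> forall y, c <= y <= d -> rcont (fun x => g (x +i* y)) x.
Proof. by move=> H xab y ycd; apply: (rcont_comp (rcont_horiz y x)); exact: H. Qed.

Let rcont_v g a b c d y : (forall x y, a <= x <= b -> c <= y <= d -> {for (x +i* y), continuous g}) ->
  c <= y <= d -> forall x, a <= x <= b -> rcont (fun y => g (x +i* y)) y.
Proof. by move=> H ycd x xab; apply: (rcont_comp (rcont_vert x y)); exact: H. Qed.

Lemma rect_int_split g a b c d m n : a <= m <= b -> c <= n <= d ->
  (forall x y, a <= x <= b -> c <= y <= d -> {for (x +i* y), continuous g}) ->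
  rect_int g a b c d = rect_int g a m c n + rect_int g m b c n +
                       rect_int g a m n d + rect_int g m b n d.
Proof.
move=> mab ncd H; rewrite /rect_int.
have /andP[am mb] := mab; have /andP[cn nd] := ncd.
have ab := le_trans am mb; have cd := le_trans cn nd.
have ain : a <= a <= b by rewrite lexx. have bin : a <= b <= b by rewrite lexx ab.
have cin : c <= c <= d by rewrite lexx. have din : c <= d <= d by rewrite lexx cd.
have hh y y' : c <= y <= d -> c <= y' <= d -> rcont_on a b (fun x => g (x +i* y) - g (x +i* y')).
  by move=> yi y'i x xab; apply: rcontB; exact: (rcont_h H).
have vv x x' : a <= x <= b -> a <= x' <= b -> rcont_on c d (fun y => g (x +i* y) - g (x' +i* y)).
  by move=> xi x'i y yab; apply: rcontB; exact: (rcont_v H).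
have sub p q p' q' (F : R -> C) : p <= p' -> q' <= q -> rcont_on p q F -> rcont_on p' q' F.
  move=> pp qq HF x /andP[x1 x2]; apply: HF.
  by rewrite (le_trans pp x1) (le_trans x2 qq).
have hs p q : a <= p -> q <= b -> cint p q (fun x => g (x +i* c) - g (x +i* d)) =
    cint p q (fun x => g (x +i* c) - g (x +i* n)) + cint p q (fun x => g (x +i* n) - g (x +i* d)).
  move=> ap qb; rewrite -cintD.
  - by apply: eq_cint => x _; rewrite addrA subrK.
  - by apply: (sub a b) => //; exact: hh.
  - by apply: (sub a b) => //; exact: hh.
have vs p q : c <= p -> q <= d -> cint p q (fun y => g (b +i* y) - g (a +i* y)) =
    cint p q (fun y => g (m +i* y) - g (a +i* y)) + cint p q (fun y => g (b +i* y) - g (m +i* y)).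
  move=> ap qb; rewrite -cintD.
  - by apply: eq_cint => x _; rewrite [RHS]addrC addrA subrK.
  - by apply: (sub c d) => //; exact: vv.
  - by apply: (sub c d) => //; exact: vv.
rewrite (cint_cat mab (hh _ _ cin din)) (cint_cat ncd (vv _ _ bin ain)).
rewrite (hs a m)// (hs m b)// (vs c n)// (vs n d)//.
ring.
Qed.

(** The bisection principle applies: the integral is additive under subdivision,
    and near a point [g] differs by [o(|w - z|)] from an affine function, whose
    integral vanishes because the contributions of the two pairs of sides are
    [- i D v u] and [i D u v], with [u] and [v] the lengths of the sides. *)
Lemma goursat g a b c d : a <= b -> c <= d ->
  (forall x y, a <= x <= b -> c <= y <= d -> exists D, is_cderive g (x +i* y) D) ->
  rect_int g a b c d = 0.
Proof.
move=> ab cd H.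
have cg x y : a <= x <= b -> c <= y <= d -> {for (x +i* y), continuous g}.
  by move=> xab ycd; have [D /is_cderive_continuous] := H x y xab ycd.
apply: (bisection ab cd).
  move=> a' b' c' d' aa ab' bb cc cd' dd m n; apply: rect_int_split.
  - by rewrite /m; lra.
  - by rewrite /n; lra.
  - by move=> x y /andP[x1 x2] /andP[y1 y2]; apply: cg; lra.
move=> x0 y0 x0ab y0cd e e0.
have [D HD] := H x0 y0 x0ab y0cd.
have e40 : 0 < e / 4 by rewrite divr_gt0.
have [r r0 Hr] := is_cderive_eps HD e40.
exists r => // a' b' c' d' /andP[aa a0] /andP[b0 bb] /andP[cc c0] /andP[d0 dd].
set s := _ + _ => sr.
have ab' : a' <= b' by lra. have cd' : c' <= d' by lra.
have s0 : 0 <= s by rewrite /s; lra.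
set z := x0 +i* y0 in HD Hr *.
pose E (w : C) : C := g w - g z - D * (w - z).
have HE x y : a' <= x <= b' -> c' <= y <= d' -> cabs (E (x +i* y)) <= e / 4 * s.
  move=> /andP[x1 x2] /andP[y1 y2].
  have ws : cabs ((x +i* y : C) - z) <= s.
    apply: (le_trans (cabs_le_ReIm _)) => /=; rewrite /s lerD// ler_norml; lra.
  by apply: (le_trans (Hr _ (le_lt_trans ws sr))); rewrite ler_wpM2l// ltW.
have cE x y : a' <= x <= b' -> c' <= y <= d' -> {for (x +i* y), continuous E}.
  move=> /andP[x1 x2] /andP[y1 y2].
  have [||D' HD'] := H x y; [lra|lra|].
  apply: (@is_cderive_continuous _ _ _ (D' - 0 - D * (1 - 0))).
  apply: is_cderiveB; first by apply: is_cderiveB => //; exact: is_cderive_cst.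
  by apply: is_cderiveZ; apply: is_cderiveB; [exact: is_cderive_id|exact: is_cderive_cst].
have a'i : a' <= a' <= b' by rewrite lexx. have b'i : a' <= b' <= b' by rewrite lexx ab'.
have c'i : c' <= c' <= d' by rewrite lexx. have d'i : c' <= d' <= d' by rewrite lexx cd'.
pose k1 : C := D * (0 +i* (c' - d')).
pose k2 : C := D * (b' - a')%:C.
pose F1 x : C := E (x +i* c') - E (x +i* d').
pose F2 y : C := E (b' +i* y) - E (a' +i* y).
have cF1 : rcont_on a' b' F1.
  by move=> x xi; apply: rcontB; exact: (rcont_h cE).
have cF2 : rcont_on c' d' F2.
  by move=> y yi; apply: rcontB; exact: (rcont_v cE).
have -> : rect_int g a' b' c' d' = cint a' b' F1 + (0 +i* 1) * cint c' d' F2.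
  rewrite /rect_int.
  rewrite (@eq_cint _ a' b' _ (fun x => k1 + F1 x)); last first.
    move=> x _; rewrite /k1 /F1 /E.
    have -> : (0 +i* (c' - d') : C) = (x +i* c' : C) - (x +i* d').
      by apply/eqP; rewrite eq_complex /= subrr !eqxx.
    by ring.
  rewrite (@eq_cint _ c' d' _ (fun y => k2 + F2 y)); last first.
    move=> y _; rewrite /k2 /F2 /E.
    have -> : ((b' - a')%:C : C) = (b' +i* y : C) - (a' +i* y).
      by apply/eqP; rewrite eq_complex /= subrr !eqxx.
    by ring.
  have ck (k : C) p q : rcont_on p q (fun=> k) by move=> x _; exact: rcont_cst.
  rewrite (cintD (ck k1 _ _) cF1) (cintD (ck k2 _ _) cF2).
  rewrite !cint_cst// /k1 /k2.
  have -> : (0 +i* (c' - d') : C) = - ((0 +i* 1) * (d' - c')%:C).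
    by apply/eqP; rewrite eq_complex /=; apply/andP; split; apply/eqP; ring.
  ring.
have B1 : cabs (cint a' b' F1) <= 2 * (2 * (e / 4 * s)) * (b' - a').
  apply: cint_norm => // x xi; apply: (le_trans (ler_cabsB _ _)).
  by rewrite [leRHS]mulr_natl mulr2n lerD// HE.
have B2 : cabs (cint c' d' F2) <= 2 * (2 * (e / 4 * s)) * (d' - c').
  apply: cint_norm => // y yi; apply: (le_trans (ler_cabsB _ _)).
  by rewrite [leRHS]mulr_natl mulr2n lerD// HE.
apply: (le_trans (ler_cabsD _ _)); rewrite cabsM.
have -> : cabs (0 +i* 1 : C) = 1 by rewrite /= expr0n expr1n add0r sqrtr1.
rewrite mul1r; apply: (le_trans (lerD B1 B2)).
by rewrite /s le_eqVlt; apply/orP; left; apply/eqP; field.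
Qed.

End GoursatRect.

(** * The complex exponential *)

Section RealDerivative.
Variable R : realType.
Implicit Types (phi : R -> R) (t d e : R).

Lemma is_derive_eps phi t d : is_derive t 1 phi d -> forall e, 0 < e ->
  exists2 r, 0 < r & forall s, `|s - t| < r -> `|phi s - phi t - d * (s - t)| <= e * `|s - t|.
Proof.
move=> [dphi <-] e e0; have := dphi.
rewrite /derivable => /cvgrPdist_le /(_ _ e0).
rewrite -/(derive phi t 1) => /nbhs_ballP [r /= r0 Hr]; exists r => // s sr.
have [->|st] := eqVneq s t; first by rewrite !subrr mulr0 subr0 normr0 mulr0.
have st0 : s - t != 0 by rewrite subr_eq0.
have := Hr (s - t); rewrite /ball /= sub0r normrN => /(_ sr st0).
rewrite [_%:A]mulr1 subrK -ler_pdivrMr ?normr_gt0// -normfV -normrM distrC.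
apply: le_trans; rewrite le_eqVlt; apply/orP; left; apply/eqP; congr `|_|.
by rewrite mulrBl mulfK// [_ *: _]mulrC.
Qed.

Lemma eps_is_derive phi t d : (forall e, 0 < e ->
  exists2 r, 0 < r & forall s, `|s - t| < r -> `|phi s - phi t - d * (s - t)| <= e * `|s - t|) ->
  is_derive t 1 phi d.
Proof.
move=> H.
have L : (fun h : R => h^-1 *: ((phi \o shift t) (h *: (1:R)) - phi t)) @ 0^' --> d.
  apply/cvgrPdist_le => e /H[r r0 Hr]; apply/nbhs_ballP; exists r => // h.
  rewrite /ball /= sub0r normrN => hr h0.
  have := Hr (h + t); rewrite addrK => /(_ hr).
  rewrite -ler_pdivrMr ?normr_gt0// -normfV -normrM distrC; apply: le_trans.
  rewrite le_eqVlt; apply/orP; left; apply/eqP; congr `|_|.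
  by rewrite mulrBl mulfK// [_%:A]mulr1 [_ *: _]mulrC.
by split; [apply/cvg_ex; exists d|apply: cvg_lim].
Qed.

End RealDerivative.

Section Cexp.
Variable R : realType.
Local Notation C := (cplx R).
Implicit Types (x y e : R) (z w : C).

Lemma cexpD z w : cexp (z + w) = cexp z * cexp w.
Proof.
case: z w => a b [c d]; rewrite /cexp /= expRD cosD sinD.
by apply/eqP; rewrite eq_complex /=; apply/andP; split; apply/eqP; ring.
Qed.

Lemma cabs_cexp z : cabs (cexp z) = expR (complex.Re z).
Proof.
rewrite /cexp cabsM cabs_real gtr0_norm ?expR_gt0//.
by rewrite /= cos2Dsin2 sqrtr1 mulr1.
Qed.

Lemma cexp_neq0 z : cexp z != 0.
Proof. by rewrite -cabs_gt0 cabs_cexp expR_gt0. Qed.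

Lemma cexp0 : cexp (0 : C) = 1.
Proof. by rewrite /cexp /= expR0 cos0 sin0 mul1r. Qed.

Lemma cexp_2pi x : cexp (x +i* (pi *+ 2)) = cexp (x +i* 0 : C).
Proof. by rewrite /cexp /= cos2pi cos0 sin0 mulr2n sinDpi sinpi oppr0. Qed.

(** Reduced to the derivatives of [expR], [cos] and [sin] at [0]: with
    [A = e^x - 1 - x], [B = cos y - 1] and [D = sin y - y], the components of
    [e^h - 1 - h] are [A cos y + (1 + x) B] and [(A + x) (D + y) + D]. *)
Let is_cderive_cexp0 : is_cderive (@cexp R) 0 1.
Proof.
apply: eps_is_cderive => e e0; rewrite cexp0.
have [k [k0 k1 ke]] : exists k, [/\ 0 < k, k <= 1 & k <= e / 16].
  exists (Order.min (e / 16) 1); split; last by rewrite ge_min lexx.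
    by rewrite lt_min divr_gt0//= ltr01.
  by rewrite ge_min lexx orbT.
have [r1 r10 H1] := is_derive_eps (is_derive_expR 0) k0.
have [r2 r20 H2] := is_derive_eps (is_derive_cos 0) k0.
have [r3 r30 H3] := is_derive_eps (is_derive_sin 0) k0.
exists (Order.min k (Order.min r1 (Order.min r2 r3))).
  by rewrite !lt_min k0 r10 r20 r30.
case=> x y; rewrite !subr0 mul1r !lt_min => /and4P[wk w1 w2 w3].
set m := cabs _ in wk w1 w2 w3 *.
have xm : `|x| <= m := Re_le_cabs (x +i* y : C).
have ym : `|y| <= m := Im_le_cabs (x +i* y : C).
have := H1 x; rewrite subr0 expR0 mul1r => /(_ (le_lt_trans xm w1)) {}H1.
have := H2 y; rewrite subr0 cos0 sin0 oppr0 mul0r subr0 => /(_ (le_lt_trans ym w2)) {}H2.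
have := H3 y; rewrite !subr0 cos0 sin0 mul1r subr0 => /(_ (le_lt_trans ym w3)) {}H3.
have m0 : 0 <= m := cabs_ge0 _.
have km := ler_pM (ltW k0) (normr_ge0 _) (lexx k) xm.
have km' := ler_pM (ltW k0) (normr_ge0 _) (lexx k) ym.
have mk : m * m <= k * m by rewrite ler_wpM2r// ltW.
have cy : `|cos y| <= 1 by rewrite ler_norml cos_geN1 cos_le1.
set A := expR x - 1 - x in H1; set B := cos y - 1 in H2; set D := sin y - y in H3.
have HA : `|A| <= k * m by lra. have HB : `|B| <= k * m by lra. have HD : `|D| <= k * m by lra.
have E1 : `|complex.Re (cexp (x +i* y : C) - 1 - (x +i* y))| <= 3 * (k * m).
  have -> : complex.Re (cexp (x +i* y : C) - 1 - (x +i* y)) = A * cos y + (1 + x) * B.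
    by rewrite /cexp /= /A /B; ring.
  apply: (le_trans (ler_normD _ _)); rewrite !normrM.
  have : `|A| * `|cos y| <= k * m * 1 by apply: ler_pM.
  have : `|1 + x| * `|B| <= 2 * (k * m).
    apply: ler_pM => //; apply: (le_trans (ler_normD _ _)); rewrite normr1; lra.
  lra.
have E2 : `|complex.Im (cexp (x +i* y : C) - 1 - (x +i* y))| <= 5 * (k * m).
  have -> : complex.Im (cexp (x +i* y : C) - 1 - (x +i* y)) = (A + x) * (D + y) + D.
    by rewrite /cexp /= /A /D; ring.
  apply: (le_trans (ler_normD _ _)); rewrite !normrM.
  have kmm : k * m <= m by rewrite ler_piMl.
  have : `|A + x| * `|D + y| <= (2 * m) * (2 * m).
    by apply: ler_pM => //; apply: (le_trans (ler_normD _ _)); lra.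
  have -> : 2 * m * (2 * m) = 4 * (m * m) by ring.
  lra.
apply: (le_trans (cabs_le_ReIm _)).
have kem : k * m <= e / 16 * m by rewrite ler_wpM2r.
have em : 0 <= e * m by rewrite mulr_ge0// ltW.
apply: (le_trans (lerD E1 E2)).
by lra.
Qed.

Lemma is_cderive_cexp z : is_cderive (@cexp R) z (cexp z).
Proof.
have H : is_cderive (fun w => w - z) z (1 - 0).
  by apply: is_cderiveB; [exact: is_cderive_id|exact: is_cderive_cst].
have H0 : is_cderive (@cexp R) (z - z) 1 by rewrite subrr; exact: is_cderive_cexp0.
have := is_cderiveZ (cexp z) (is_cderive_comp H H0).
rewrite subr0 !mulr1; apply: is_cderive_near; apply: filterE => w.
by rewrite /= -cexpD addrC subrK.
Qed.

End Cexp.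

(** * Holomorphic functions have holomorphic derivatives *)

Section Regularity.
Variable R : realType.
Local Notation C := (cplx R).
Implicit Types (r e : R) (f : C -> C) (z w h d : C).

(** The circle of radius [r], as the image of a vertical segment under the
    exponential: this is how Goursat's theorem for rectangles reaches it. *)
Definition circ r (t : R) : C := cexp (ln r +i* t : C).

Lemma cabs_circ r t : 0 < r -> cabs (circ r t) = r.
Proof. by move=> r0; rewrite /circ cabs_cexp /= lnK. Qed.

Lemma circ_neq0 r t : circ r t != 0.
Proof. exact: cexp_neq0. Qed.

Lemma rcont_circ r t : rcont (circ r) t.
Proof.
apply: (rcont_comp (rcont_vert (ln r) t)).
exact: (is_cderive_continuous (is_cderive_cexp _)).
Qed.

Let pi2 : 0 <= pi *+ 2 :> R.
Proof. by rewrite mulrn_wge0// pi_ge0. Qed.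

Lemma rcont_kernel f z r t : {for (z + circ r t), continuous f} ->
  rcont (fun t => (f (z + circ r t) - f z) / circ r t) t.
Proof.
move=> cf; have H1 : {for (circ r t), continuous (fun v => f (z + v))}.
  by apply: (continuous_comp _ cf); exact: (ccontD (ccont_cst z _) (ccont_id _)).
have H2 : {for (circ r t), continuous (fun v => (f (z + v) - f z) / v)}.
  have H3 := ccontD H1 (ccont_cst (- f z) _).
  exact: (ccontM H3 (@ccontV _ (fun v => v) _ (circ_neq0 r t) (ccont_id _))).
exact: (rcont_comp (rcont_circ r t) H2).
Qed.

(** The function [g w = (f (z + e^w) - f z) / e^w] is holomorphic for
    [Re w <= ln r] and has period [2 pi i]. On the rectangle with real parts from
    [ln s] to [ln r] and height [2 pi] the horizontal sides cancel, so by
    Goursat's theorem the integral over the left side is that over the right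
    side. As [s] goes to [0] the integrand on the left tends to [d]. *)
Lemma circle_derivative f z r d : 0 < r ->
  (forall w, cabs (w - z) <= r -> exists D, is_cderive f w D) -> is_cderive f z d ->
  cint 0 (pi *+ 2) (fun t => (f (z + circ r t) - f z) / circ r t) = (pi *+ 2)%:C * d.
Proof.
move=> r0 H Hd; set I := cint _ _ _.
apply/eqP; rewrite -subr_eq0 -cabs_eq0 eq_le cabs_ge0 andbT.
apply/ler_addgt0Pl => e' e'0; rewrite addr0.
have [e [e0 ee']] : exists e, 0 < e /\ 2 * e * (pi *+ 2) <= e'.
  exists (e' / (2 * (pi *+ 2))).
  have pi20 : 0 < pi *+ 2 :> R by rewrite mulrn_wgt0// pi_gt0.
  split; first by rewrite divr_gt0// mulr_gt0.
  rewrite le_eqVlt; apply/orP; left; apply/eqP; move: (pi *+ 2) pi20 => p p0.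
  by field; rewrite gt_eqF.
apply: le_trans ee'.
have [dl dl0 Hdl] := is_cderive_eps Hd e0.
pose s := Order.min r (dl / 2).
have s0 : 0 < s by rewrite lt_min r0 divr_gt0.
have sr : s <= r by rewrite ge_min lexx.
have sdl : s < dl by rewrite gt_min; apply/orP; right; lra.
pose g w : C := (f (z + cexp w) - f z) / cexp w.
have rect0 : rect_int g (ln s) (ln r) 0 (pi *+ 2) = 0.
  apply: goursat => //; first by rewrite ler_ln.
  move=> x y /andP[x1 x2] _.
  have wr : cabs (z + cexp (x +i* y : C) - z) <= r.
    by rewrite addrC addKr cabs_cexp /= -(lnK r0) ler_expR.
  have [D HD] := H _ wr.
  have Hexp := is_cderive_cexp (x +i* y : C).
  have H1 := is_cderiveD (is_cderive_cst z _) Hexp.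
  have H2 := is_cderiveB (is_cderive_comp H1 HD) (is_cderive_cst (f z) _).
  eexists; exact: (is_cderiveM H2 (is_cderiveV (cexp_neq0 _) Hexp)).
have cont q t : 0 < q -> q <= r -> rcont (fun t => (f (z + circ q t) - f z) / circ q t) t.
  move=> q0 qr; apply: rcont_kernel.
  have [|D /is_cderive_continuous//] := H (z + circ q t).
  by rewrite addrC addKr cabs_circ.
have V0 : cint 0 (pi *+ 2) (fun y => g (ln r +i* y) - g (ln s +i* y)) = 0.
  move: rect0; rewrite /rect_int (@eq_cint _ _ _ _ (fun=> 0)).
    rewrite cint_cst ?ler_ln// mulr0 add0r => /eqP.
    by rewrite mulf_eq0 eq_complex /= oner_eq0 andbF /= => /eqP.
  by move=> x _; rewrite /g cexp_2pi subrr.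
pose u t : C := (f (z + circ s t) - f z) / circ s t - d.
have cu : rcont_on 0 (pi *+ 2) u.
  by move=> t _; apply: rcontB; [exact: cont|exact: rcont_cst].
have -> : I - (pi *+ 2)%:C * d = cint 0 (pi *+ 2) u.
  rewrite /I (@eq_cint _ _ _ _ (fun t => (g (ln r +i* t) - g (ln s +i* t)) + (u t + d))); last first.
    by move=> t _; rewrite /u /g /circ subrK subrK.
  have cd : rcont_on 0 (pi *+ 2) (fun=> d) by move=> t _; exact: rcont_cst.
  rewrite cintD.
  - by rewrite (cintD cu cd) cint_cst// V0 add0r subr0 addrK.
  - by move=> t _; apply: rcontB; exact: cont.
  - by move=> t ti; apply: rcontD; [exact: cu|exact: cd].
have := @cint_norm _ 0 (pi *+ 2) u e pi2 cu; rewrite subr0; apply => t _; rewrite /u.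
have := Hdl (z + circ s t); rewrite addrC addKr cabs_circ// => /(_ sdl) {}Hdl.
rewrite -(ler_pM2r s0) -[X in _ * X <= _](cabs_circ t s0) -cabsM mulrBl mulfVK ?circ_neq0//.
Qed.

(** Compactness of the segment. *)
Lemma unif_segment (T : R) (P : R -> C -> Prop) :
  (forall t0, 0 <= t0 <= T -> exists2 e, 0 < e &
     forall t, `|t - t0| < e -> forall h, cabs h < e -> P t h) ->
  exists2 e, 0 < e & forall t, 0 <= t <= T -> forall h, cabs h < e -> P t h.
Proof.
move=> H.
have [+ _] := compact_near_coveringP (`[0, T] : set R) => /(_ (@segment_compact R 0 T)).
move=> /(_ C (nbhs (0 : C)) (fun h t => P t h) _) K.
have /K /nbhs_cabsP[e e0 He] : forall t0, `[0, T]%classic t0 ->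
    \forall t \near t0 & h \near nbhs (0 : C), P t h.
  move=> t0 /=; rewrite in_itv /= => /H[e e0 He].
  exists ([set t : R | `|t - t0| < e], [set h : C | cabs h < e]).
    split => /=; last by apply/nbhs_cabsP; exists e => // w; rewrite subr0.
    by apply/nbhs_ballP; exists e => // t; rewrite /ball /= distrC.
  by case=> t h /= [t1 t2]; exact: He.
exists e => // t ti h he; apply: (He h); first by rewrite subr0.
by rewrite /= in_itv.
Qed.



Lemma is_derive_line f z h t d : is_cderive f (z + t%:C * h) d ->
  is_derive t 1 (fun s : R => complex.Re (f (z + s%:C * h))) (complex.Re (d * h)) /\
  is_derive t 1 (fun s : R => complex.Im (f (z + s%:C * h))) (complex.Im (d * h)).
Proof.
move=> /is_cderive_eps H.
have K (pr : {additive C -> R}) : (forall w : C, `|pr w| <= cabs w) ->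
    (forall (x : R) (w : C), pr (x%:C * w) = x * pr w) ->
    is_derive t 1 (fun s : R => pr (f (z + s%:C * h))) (pr (d * h)).
  move=> prle prZ; apply: eps_is_derive => e e0.
  have hk : 0 < cabs h + 1 by rewrite ltr_wpDl ?cabs_ge0.
  have [|r r0 Hr] := H (e / (cabs h + 1)); first by rewrite divr_gt0.
  exists (r / (cabs h + 1)); first by rewrite divr_gt0.
  move=> s; rewrite ltr_pdivlMr// => sr.
  have E : z + s%:C * h - (z + t%:C * h) = (s - t)%:C * h.
    by rewrite raddfB mulrBl opprD addrACA subrr add0r.
  have := Hr (z + s%:C * h); rewrite E cabsM cabs_real.
  have sth : `|s - t| * cabs h <= `|s - t| * (cabs h + 1) by rewrite ler_wpM2l// lerDl.
  move=> /(_ (le_lt_trans sth sr)) Hs.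
  have -> : pr (f (z + s%:C * h)) - pr (f (z + t%:C * h)) - pr (d * h) * (s - t) =
      pr (f (z + s%:C * h) - f (z + t%:C * h) - d * ((s - t)%:C * h)).
    by rewrite [d * (_ * _)]mulrCA !(raddfB pr) prZ [_ * (s - t)]mulrC.
  apply: (le_trans (prle _)); apply: (le_trans Hs).
  have -> : e * `|s - t| = e / (cabs h + 1) * (`|s - t| * (cabs h + 1)).
    by field; exact: lt0r_neq0.
  by rewrite ler_wpM2l// divr_ge0// ltW.
split; [apply: (K (@complex.Re R))|apply: (K (@complex.Im R))].
- exact: Re_le_cabs.
- by move=> x [a b] /=; rewrite mul0r subr0.
- exact: Im_le_cabs.
- by move=> x [a b] /=; rewrite mul0r addr0.
Qed.

(** The mean value theorem along the segment from [z] to [z + h], applied to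
    each component of [f w - c (w - z)]. *)
Lemma increment_le f (f' : C -> C) z h c e : 
  (forall t : R, 0 <= t <= 1 -> is_cderive f (z + t%:C * h) (f' (z + t%:C * h)) /\
     cabs (f' (z + t%:C * h) - c) <= e) ->
  cabs (f (z + h) - f z - c * h) <= 2 * e * cabs h.
Proof.
move=> H.
pose F w := f w - c * (w - z).
have HF (t : R) : 0 <= t <= 1 -> is_cderive F (z + t%:C * h) (f' (z + t%:C * h) - c).
  move=> /H[H1 _]; have H2 := is_cderiveB (is_cderive_id (z + t%:C * h)) (is_cderive_cst z _).
  by have := is_cderiveB H1 (is_cderiveZ c H2); rewrite subr0 mulr1.
have E : f (z + h) - f z - c * h = F (z + 1%:C * h) - F (z + 0%:C * h).
  by rewrite /F mul1r mul0r addr0 subrr mulr0 subr0 [z + h - z]addrC addKr; ring.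
rewrite E; apply: (le_trans (cabs_le_ReIm _)).
have K (pr : {additive C -> R}) : (forall w : C, `|pr w| <= cabs w) ->
    (forall t : R, 0 <= t <= 1 -> is_derive t 1 (fun s : R => pr (F (z + s%:C * h)))
       (pr ((f' (z + t%:C * h) - c) * h))) ->
    `|pr (F (z + 1%:C * h) - F (z + 0%:C * h))| <= e * cabs h.
  move=> prle Hd.
  have [||s] := @MVT_segment R (fun s : R => pr (F (z + s%:C * h)))
    (fun t : R => pr ((f' (z + t%:C * h) - c) * h)) 0 1 ler01.
  - move=> t; rewrite in_itv /= => /andP[t0 t1]; apply: Hd; lra.
  - apply: derivable_within_continuous => t; rewrite in_itv /= => ti.
    by have [] := Hd t ti.
  rewrite in_itv /= => si E1; rewrite raddfB E1 subr0 mulr1.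
  by apply: (le_trans (prle _)); rewrite cabsM ler_wpM2r ?cabs_ge0//; exact: (H s si).2.
have := K (@complex.Re R) (@Re_le_cabs R) (fun t ti => (is_derive_line (HF t ti)).1).
have := K (@complex.Im R) (@Im_le_cabs R) (fun t ti => (is_derive_line (HF t ti)).2).
rewrite /=; lra.
Qed.

End Regularity.

Section DerivativeHolomorphic.
Variable R : realType.
Local Notation C := (cplx R).
Implicit Types (r e : R) (f : C -> C) (z w h d : C).

Let pi20 : 0 < pi *+ 2 :> R.
Proof. by rewrite mulrn_wgt0// pi_gt0. Qed.

(** Estimates that hold near each point of a circle hold uniformly on it; this
    justifies passing to the limit under the integral of [circle_derivative]. *)
Lemma circ_unif (P : C -> C -> Prop) z r :
  (forall w, cabs (w - z) = r -> exists2 e, 0 < e & forall v h, cabs (v - w) < e -> cabs h < e ->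
     P v h) -> 0 < r ->
  exists2 e, 0 < e & forall t, 0 <= t <= pi *+ 2 -> forall h, cabs h < e -> P (z + circ r t) h.
Proof.
move=> H r0; apply: unif_segment => t0 _.
have [|e e0 He] := H (z + circ r t0); first by rewrite addrC addKr cabs_circ.
have /rcontP /(_ e e0)[d d0 Hd] := rcont_circ r t0.
exists (Order.min d e); first by rewrite lt_min d0.
move=> t; rewrite lt_min => /andP[td _] h; rewrite lt_min => /andP[_ he].
by apply: He => //; rewrite opprD addrACA subrr add0r Hd.
Qed.

Variables (f f' : C -> C) (z0 : C) (rho : R).
Hypotheses (rho0 : 0 < rho)
  (Hf : forall w, cabs (w - z0) < rho -> is_cderive f w (f' w)).

Let r := rho / 4.
Let r0 : 0 < r. Proof. by rewrite divr_gt0. Qed.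
Let kernel (g : C -> C) z t := (g (z + circ r t) - g z) / circ r t.

Let ball_r z : cabs (z - z0) < r -> forall w, cabs (w - z) <= r -> cabs (w - z0) < rho.
Proof.
move=> zr w wr; have -> : w - z0 = (w - z) + (z - z0) by rewrite addrA subrK.
by apply: (le_lt_trans (ler_cabsD _ _)); move: zr wr; rewrite /r; have := rho0; lra.
Qed.

(** The radius is the same for all [z] near [z0]: only thus can the average be
    differentiated in [z]. *)
Let formula z : cabs (z - z0) < r -> cint 0 (pi *+ 2) (kernel f z) = (pi *+ 2)%:C * f' z.
Proof.
move=> zr; apply: circle_derivative => //.
  by move=> w wr; exists (f' w); apply/Hf/(ball_r zr).
by apply/Hf/(ball_r zr); rewrite subrr cabs0 ltW.
Qed.

Let rcont_kern z : cabs (z - z0) < r -> rcont_on 0 (pi *+ 2) (kernel f z).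
Proof.
move=> zr t _; apply: rcont_kernel.
apply: (@is_cderive_continuous _ _ _ (f' (z + circ r t))).
by apply/Hf/(ball_r zr); rewrite addrC addKr cabs_circ.
Qed.

Let z0r : cabs (z0 - z0) < r. Proof. by rewrite subrr cabs0. Qed.

Let ctsf w : cabs (w - z0) <= r -> {for w, continuous f}.
Proof. by move=> wr; apply: is_cderive_continuous (Hf (ball_r z0r wr)). Qed.

(** By [formula], [f' z - f' z0] is an average of increments of [f] over [z - z0],
    taken at [z0] and at the points of a circle, and [f] is continuous uniformly
    on that circle. *)
Lemma holomorphic_deriv_continuous : {for z0, continuous f'}.
Proof.
apply/continuous_cabsP => e e0.
pose eta := e * r / 8; have eta0 : 0 < eta by rewrite divr_gt0// mulr_gt0.
have Hc w : cabs (w - z0) <= r -> exists2 e, 0 < e & forall v h, cabs (v - w) < e ->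
    cabs h < e -> cabs (f (v + h) - f v) <= eta.
  move=> /ctsf/continuous_cabsP cw.
  have [|d d0 Hd] := cw (eta / 2); first by rewrite divr_gt0.
  exists (d / 2); first by rewrite divr_gt0.
  move=> v h vw hd.
  have -> : f (v + h) - f v = (f (v + h) - f w) - (f v - f w) by rewrite opprB addrA subrK.
  apply: (le_trans (ler_cabsB _ _)); rewrite [leRHS]splitr lerD// ltW//; apply: Hd.
    by rewrite addrAC (splitr d) (le_lt_trans (ler_cabsD _ _))// ltrD.
  by apply: (lt_trans vw); rewrite gtr_pMr// invf_lt1// ltr1n.
have [e1 e10 H1] := @circ_unif (fun v h => cabs (f (v + h) - f v) <= eta) z0 r
  (fun w wr => Hc w (eq_ind_r (fun x => x <= r) (lexx r) wr)) r0.
have [e2 e20 H2] := Hc z0 (ltW z0r).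
exists (Order.min r (Order.min e1 e2)); first by rewrite !lt_min r0 e10 e20.
move=> z; rewrite !lt_min => /and3P[zr z1 z2].
pose G t : C := kernel f z t - kernel f z0 t.
have cG : rcont_on 0 (pi *+ 2) G by move=> t ti; apply: rcontB; exact: rcont_kern.
have E : (pi *+ 2)%:C * (f' z - f' z0) = cint 0 (pi *+ 2) G.
  rewrite mulrBr -!formula//; apply/eqP; rewrite subr_eq -cintD//; last exact: rcont_kern.
  by apply/eqP/eq_cint => t _; rewrite subrK.
have := cint_norm (M := e / 4) (ltW pi20) cG.
rewrite -E cabsM cabs_real gtr0_norm// subr0 [leRHS]mulrC ler_pM2l//.
move=> H; apply: le_lt_trans (H _) _; last by lra.
move=> t ti; rewrite /G /kernel -mulrBl cabsM cabsV cabs_circ// ler_pdivrMr//.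
have -> : f (z + circ r t) - f z - (f (z0 + circ r t) - f z0) =
   (f (z0 + circ r t + (z - z0)) - f (z0 + circ r t)) - (f (z0 + (z - z0)) - f z0).
  have -> : z0 + circ r t + (z - z0) = z + circ r t by ring.
  have -> : z0 + (z - z0) = z by ring.
  by ring.
apply: (le_trans (ler_cabsB _ _)).
have -> : e / 4 * r = eta + eta by rewrite /eta; field.
by rewrite lerD ?H1// H2 ?subrr ?cabs0.
Qed.

Hypothesis Hc : forall w, cabs (w - z0) < rho -> {for w, continuous f'}.

(** Differentiation of [formula] under the integral sign: the candidate derivative
    is the same average formed with [f'], and the error is an average of the
    remainders [A v h], which are [o(|h|)] uniformly because [f'] is continuous. *)
Lemma holomorphic_deriv_derivable : exists D, is_cderive f' z0 D.
Proof.
have ck' : rcont_on 0 (pi *+ 2) (kernel f' z0).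
  move=> t _; apply: rcont_kernel; apply/Hc/(ball_r z0r).
  by rewrite addrC addKr cabs_circ.
exists (((pi *+ 2)%:C)^-1 * cint 0 (pi *+ 2) (kernel f' z0)).
have pc : (pi *+ 2)%:C != 0 :> C by rewrite -cabs_gt0 cabs_real gtr0_norm.
set D := _ * _.
have ED : (pi *+ 2)%:C * D = cint 0 (pi *+ 2) (kernel f' z0) by rewrite /D mulVKf.
apply: eps_is_cderive => e e0.
pose eta := e * r / 4; have eta0 : 0 < eta by rewrite divr_gt0// mulr_gt0.
pose A w h := f (w + h) - f w - f' w * h.
have HA w : cabs (w - z0) <= r -> exists2 e, 0 < e & forall v h, cabs (v - w) < e ->
    cabs h < e -> cabs (A v h) <= eta * cabs h.
  move=> wr; have /continuous_cabsP cw := Hc (ball_r z0r wr).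
  have [|d d0 Hd] := cw (eta / 4); first by rewrite divr_gt0.
  exists (Order.min (d / 2) r); first by rewrite lt_min r0 divr_gt0.
  move=> v h; rewrite !lt_min => /andP[vw vr] /andP[hd hr].
  have -> : eta * cabs h = 2 * (eta / 2) * cabs h by field.
  apply: (@increment_le _ f f') => t /andP[t0 t1].
  have th : cabs (t%:C * h) <= cabs h.
    by rewrite cabsM cabs_real ger0_norm// ler_piMl// cabs_ge0.
  split.
    apply: Hf; have -> : v + t%:C * h - z0 = (v - w) + t%:C * h + (w - z0) by ring.
    apply: (le_lt_trans (ler_cabsD _ _)); apply: (le_lt_trans (lerD (ler_cabsD _ _) (lexx _))).
    by move: wr vr hr th; rewrite /r; have := rho0; lra.
  have -> : f' (v + t%:C * h) - f' v = (f' (v + t%:C * h) - f' w) - (f' v - f' w).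
    by rewrite opprB addrA subrK.
  apply: (le_trans (ler_cabsB _ _)).
  have -> : eta / 2 = eta / 4 + eta / 4 by field.
  apply: lerD; apply: ltW; apply: Hd.
    by rewrite addrAC; apply: (le_lt_trans (ler_cabsD _ _)); move: vw hd th; lra.
  by move: vw; have := d0; lra.
have [e1 e10 H1] := @circ_unif (fun v h => cabs (A v h) <= eta * cabs h) z0 r
  (fun w wr => HA w (eq_ind_r (fun x => x <= r) (lexx r) wr)) r0.
have [e2 e20 H2] := HA z0 (ltW z0r).
exists (Order.min r (Order.min e1 e2)); first by rewrite !lt_min r0 e10 e20.
move=> z; rewrite !lt_min => /and3P[zr z1 z2]; set h := z - z0 in z1 z2 *.
pose G t : C := kernel f z t - kernel f z0 t - h * kernel f' z0 t.
have chk : rcont_on 0 (pi *+ 2) (fun t => h * kernel f' z0 t).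
  move=> t ti; apply: (@rcont_comp _ (fun w => h * w)); first exact: ck'.
  exact: (ccontM (ccont_cst h _) (ccont_id _)).
have cG : rcont_on 0 (pi *+ 2) G.
  by move=> t ti; apply: rcontB; [apply: rcontB; exact: rcont_kern|exact: chk].
have E : (pi *+ 2)%:C * (f' z - f' z0 - D * h) = cint 0 (pi *+ 2) G.
  rewrite 2!mulrBr -!formula// mulrA ED (mulrC (cint _ _ _) h) -cintZ//.
  apply/eqP; rewrite !subr_eq -!cintD//; try exact: rcont_kern.
    by apply/eqP/eq_cint => t _; rewrite /G !subrK.
  by move=> t ti; apply: rcontD; [exact: cG|exact: chk].
have := cint_norm (M := e / 2 * cabs h) (ltW pi20) cG.
rewrite -E cabsM cabs_real gtr0_norm// subr0 [leRHS]mulrC ler_pM2l//.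
have -> : 2 * (e / 2 * cabs h) = e * cabs h by field.
apply => t ti; rewrite /G /kernel.
have -> : (f (z + circ r t) - f z) / circ r t - (f (z0 + circ r t) - f z0) / circ r t
   - h * ((f' (z0 + circ r t) - f' z0) / circ r t) = (A (z0 + circ r t) h - A z0 h) / circ r t.
  have -> : A (z0 + circ r t) h = f (z + circ r t) - f (z0 + circ r t) - f' (z0 + circ r t) * h.
    rewrite /A; have -> : z0 + circ r t + h = z + circ r t by rewrite /h; ring.
    by [].
  have -> : A z0 h = f z - f z0 - f' z0 * h by rewrite /A (_ : z0 + h = z)// /h; ring.
  by ring.
rewrite cabsM cabsV cabs_circ// ler_pdivrMr//.
apply: (le_trans (ler_cabsB _ _)).
have -> : e / 2 * cabs h * r = eta * cabs h + eta * cabs h by rewrite /eta; field.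
by rewrite lerD ?H1// H2 ?subrr ?cabs0.
Qed.

End DerivativeHolomorphic.

Section Holomorphic.
Variable R : realType.
Local Notation C := (cplx R).

(** Iterating this gives derivatives of every order. Continuity of [f'] near [w],
    needed for its differentiability at [w], comes from the same hypothesis. *)
Lemma holomorphic_deriv (f f' : C -> C) (z : C) :
  (\forall w \near z, is_cderive f w (f' w)) ->
  \forall w \near z, is_cderive f' w (derive1 f' w).
Proof.
move=> /nbhs_cabsP[e e0 He]; apply/nbhs_cabsP; exists (e / 2); first by rewrite divr_gt0.
move=> w we.
have e20 : 0 < e / 2 by rewrite divr_gt0.
have Hw v : cabs (v - w) < e / 2 -> is_cderive f v (f' v).
  move=> vw; apply: He; have -> : v - z = (v - w) + (w - z) by rewrite addrA subrK.
  by rewrite (splitr e) (le_lt_trans (ler_cabsD _ _))// ltrD.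
have e40 : 0 < e / 2 / 2 by rewrite divr_gt0.
have [||D HD] := @holomorphic_deriv_derivable R f f' w _ e40.
- by move=> v vw; apply: Hw; apply: (lt_trans vw); lra.
- move=> v vw; apply: (holomorphic_deriv_continuous (f := f) e40) => u uv; apply: Hw.
  have -> : u - w = (u - v) + (v - w) by rewrite addrA subrK.
  by rewrite (splitr (e / 2)) (le_lt_trans (ler_cabsD _ _))// ltrD.
by have /is_cderiveP[_ ->] := HD.
Qed.

End Holomorphic.

(** * Wirtinger derivatives *)

Section Wirtinger.
Variable R : realType.
Local Notation C := (cplx R).
Local Notation cj := (conjc : C -> C).
Implicit Types (F G : C -> C) (u : C -> R) (z w a b : C).

Lemma cabs_conj z : cabs (conjc z) = cabs z.
Proof. by case: z => x y /=; rewrite sqrrN. Qed.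

Lemma ccont_conj F z : {for z, continuous F} -> {for z, continuous (fun w => cj (F w))}.
Proof.
move=> /continuous_cabsP cF; apply/continuous_cabsP => e /cF[d d0 Hd].
by exists d => // w /Hd; rewrite -(raddfB (@conjc R)) cabs_conj.
Qed.

Lemma conjD z w : cj (z + w) = cj z + cj w.
Proof. exact: (raddfD (@conjc R)). Qed.

Lemma conjB z w : cj (z - w) = cj z - cj w.
Proof. exact: (raddfB (@conjc R)). Qed.

Lemma conjM z w : cj (z * w) = cj z * cj w.
Proof. exact: (rmorphM (@conjc R)). Qed.

(** Real differentiability at [z] with [dF = a dz + b d(conj z)], again in
    Caratheodory's form so that the rules of calculus are algebra. *)
Definition is_wirtinger F z a b := exists p q : C -> C,
  [/\ {for z, continuous p}, {for z, continuous q},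
      \forall w \near z, F w - F z = p w * (w - z) + q w * cj (w - z),
      p z = a & q z = b].

Lemma is_wirtinger_near F G z a b :
  (\forall w \near z, F w = G w) -> is_wirtinger F z a b -> is_wirtinger G z a b.
Proof.
move=> FG [p [q [cp cq H pa qb]]]; exists p, q.
have FGz : F z = G z := nbhs_singleton FG.
have H' : \forall w \near z, G w - G z = p w * (w - z) + q w * cj (w - z).
  by apply: filterS2 FG H => w <-; rewrite FGz.
exact: (And5 cp cq H' pa qb).
Qed.

Lemma is_wirtinger_continuous F z a b : is_wirtinger F z a b -> {for z, continuous F}.
Proof.
case=> p [q [cp cq H _ _]].
have cz : {for z, continuous (fun w => w - z)} := ccontD (ccont_id z) (ccont_cst (- z) z).
have K : {for z, continuous (fun w => (p w * (w - z) + q w * cj (w - z)) + F z)}.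
  exact: (ccontD (ccontD (ccontM cp cz) (ccontM cq (ccont_conj cz))) (ccont_cst (F z) z)).
move=> P FP; have := K P; rewrite subrr (raddf0 (@conjc R)) !mulr0 addr0 add0r => /(_ FP) HP.
have {}HP : \forall w \near z, P ((p w * (w - z) + q w * cj (w - z)) + F z) := HP.
have : \forall w \near z, P (F w).
  by apply: filterS2 H HP => w E; rewrite -E subrK.
by [].
Qed.

Lemma is_wirtinger_holo F z a : is_cderive F z a -> is_wirtinger F z a 0.
Proof.
case=> p cp [H pa]; exists p, (fun=> 0).
have H' : \forall w \near z, F w - F z = p w * (w - z) + 0 * cj (w - z).
  by apply: filterS H => w ->; rewrite mul0r addr0.
exact: (And5 cp (ccont_cst 0 z) H' pa (erefl 0)).
Qed.

Lemma is_wirtinger_cst (c : C) z : is_wirtinger (fun=> c) z 0 0.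
Proof. exact/is_wirtinger_holo/is_cderive_cst. Qed.

Lemma is_wirtingerD F G z a b a' b' : is_wirtinger F z a b -> is_wirtinger G z a' b' ->
  is_wirtinger (fun w => F w + G w) z (a + a') (b + b').
Proof.
move=> [p [q [cp cq H <- <-]]] [p' [q' [cp' cq' H' <- <-]]].
exists (fun w => p w + p' w), (fun w => q w + q' w).
apply: (And5 (ccontD cp cp') (ccontD cq cq') _ (erefl _) (erefl _)).
by apply: filterS2 H H' => w E E'; rewrite opprD addrACA E E'; ring.
Qed.

Lemma is_wirtingerM F G z a b a' b' : is_wirtinger F z a b -> is_wirtinger G z a' b' ->
  is_wirtinger (fun w => F w * G w) z (a * G z + F z * a') (b * G z + F z * b').
Proof.
move=> HF; have cF := is_wirtinger_continuous HF; case: HF.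
move=> p [q [cp cq H <- <-]] [p' [q' [cp' cq' H' <- <-]]].
exists (fun w => p w * G z + F w * p' w), (fun w => q w * G z + F w * q' w).
apply: (And5 (ccontD (ccontM cp (ccont_cst (G z) z)) (ccontM cF cp'))
  (ccontD (ccontM cq (ccont_cst (G z) z)) (ccontM cF cq')) _ (erefl _) (erefl _)).
apply: filterS2 H H' => w E E'.
have -> : F w * G w - F z * G z = (F w - F z) * G z + F w * (G w - G z) by ring.
by rewrite E E'; ring.
Qed.

Lemma is_wirtinger_conj F z a b : is_wirtinger F z a b ->
  is_wirtinger (fun w => cj (F w)) z (cj b) (cj a).
Proof.
move=> [p [q [cp cq H <- <-]]].
exists (fun w => cj (q w)), (fun w => cj (p w)).
apply: (And5 (ccont_conj cq) (ccont_conj cp) _ (erefl _) (erefl _)).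
by apply: filterS H => w E; rewrite -conjB E (conjD (p w * _)) (conjM (p w)) (conjM (q w)) conjcK addrC.
Qed.

Lemma is_wirtinger_comp F G z a b d : is_wirtinger F z a b -> is_cderive G (F z) d ->
  is_wirtinger (fun w => G (F w)) z (d * a) (d * b).
Proof.
move=> HF [Q cQ [HQ <-]]; have cF := is_wirtinger_continuous HF.
case: HF => p [q [cp cq H <- <-]].
have cQF := continuous_comp cF cQ.
exists (fun w => Q (F w) * p w), (fun w => Q (F w) * q w).
apply: (And5 (ccontM cQF cp) (ccontM cQF cq) _ (erefl _) (erefl _)).
have := cF _ HQ => HQ'.
have {}HQ' : \forall w \near z, G (F w) - G (F z) = Q (F w) * (F w - F z) := HQ'.
by apply: filterS2 H HQ' => w E ->; rewrite E mulrDr !mulrA.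
Qed.

Lemma is_wirtingerZ (c : C) F z a b : is_wirtinger F z a b ->
  is_wirtinger (fun w => c * F w) z (c * a) (c * b).
Proof.
by move=> /(is_wirtingerM (is_wirtinger_cst c z)); rewrite !mul0r !add0r.
Qed.

Lemma is_wirtingerB F G z a b a' b' : is_wirtinger F z a b -> is_wirtinger G z a' b' ->
  is_wirtinger (fun w => F w - G w) z (a - a') (b - b').
Proof.
move=> HF /(is_wirtingerZ (-1)) HG; have := is_wirtingerD HF HG.
by rewrite !mulN1r; apply: is_wirtinger_near; apply: filterE => w; rewrite mulN1r.
Qed.

Lemma is_wirtingerV F z a b : is_wirtinger F z a b -> F z != 0 ->
  is_wirtinger (fun w => (F w)^-1) z (- a / F z ^+ 2) (- b / F z ^+ 2).
Proof.
move=> HF Fz; have H1 := is_cderiveV Fz (is_cderive_id (F z)).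
by have := is_wirtinger_comp HF H1; rewrite mulrAC mulN1r [X in is_wirtinger _ _ _ X]mulrAC mulN1r.
Qed.

(** Chain rule for a real function of a real density; [ln] is the case of
    interest. *)
Lemma is_wirtinger_real (phi : R -> R) u z a b d :
  is_wirtinger (fun w => (u w)%:C) z a b -> is_derive (u z) 1 phi d ->
  is_wirtinger (fun w => (phi (u w))%:C) z (d%:C * a) (d%:C * b).
Proof.
move=> HF Hphi; have cF := is_wirtinger_continuous HF.
case: HF => p [q [cp cq H <- <-]].
pose Q (x : R) := if x == u z then d else (phi x - phi (u z)) / (x - u z).
have cQ : {for z, continuous (fun w => (Q (u w))%:C : C)}.
  apply/continuous_cabsP => e e0.
  have e20 : 0 < e / 2 by rewrite divr_gt0.
  have [r r0 Hr] := is_derive_eps Hphi e20.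
  have /continuous_cabsP /(_ r r0)[dl dl0 Hdl] := cF.
  exists dl => // w /Hdl; rewrite -!raddfB !cabs_real /Q eqxx => uw.
  have [_|neq] := eqVneq (u w) (u z); first by rewrite subrr normr0.
  have n0 : 0 < `|u w - u z| by rewrite normr_gt0 subr_eq0.
  have := Hr _ uw.
  have -> : phi (u w) - phi (u z) - d * (u w - u z) =
     ((phi (u w) - phi (u z)) / (u w - u z) - d) * (u w - u z).
    by rewrite mulrBl divfK// subr_eq0.
  rewrite normrM ler_pM2r// => /le_lt_trans; apply.
  by rewrite gtr_pMr// invf_lt1// ltr1n.
exists (fun w => (Q (u w))%:C * p w), (fun w => (Q (u w))%:C * q w); split.
- exact: (ccontM cQ cp).
- exact: (ccontM cQ cq).
- apply: filterS H => w E; rewrite -!mulrA -mulrDr -E -!raddfB -rmorphM /=; congr (_%:C).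
  rewrite /Q; have [->|neq] := eqVneq (u w) (u z); first by rewrite !subrr mulr0.
  by rewrite divfK// subr_eq0.
- by rewrite /Q eqxx.
- by rewrite /Q eqxx.
Qed.

(** The directional derivative along [v] is [a v + b (conj v)]; [v = 1] and
    [v = i] give the two partial derivatives. *)
Lemma is_wirtinger_partial F z a b (v : C) : is_wirtinger F z a b ->
  is_derive (0:R) 1 (fun h : R => complex.Re (F (z + h%:C * v))) (complex.Re (a * v + b * cj v)) /\
  is_derive (0:R) 1 (fun h : R => complex.Im (F (z + h%:C * v))) (complex.Im (a * v + b * cj v)).
Proof.
move=> [p [q [cp cq /nbhs_cabsP[r r0 Hr] <- <-]]].
pose S (w : C) := p w * v + q w * cj v.
have cS : {for z, continuous S}.
  exact: (ccontD (ccontM cp (ccont_cst v z)) (ccontM cq (ccont_cst (cj v) z))).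
have vk : 0 < cabs v + 1 by rewrite ltr_wpDl ?cabs_ge0.
have K (e : R) : 0 < e -> exists2 s : R, 0 < s & forall h : R, `|h - 0| < s ->
    cabs (F (z + h%:C * v) - F (z + 0%:C * v) - S z * (h - 0)%:C) <= e * `|h - 0|.
  move=> e0; have /continuous_cabsP /(_ e e0)[d d0 Hd] := cS.
  exists (Order.min r d / (cabs v + 1)); first by rewrite divr_gt0// lt_min r0.
  move=> h; rewrite subr0 ltr_pdivlMr// => hs.
  have hv : cabs (h%:C * v) < Order.min r d.
    by rewrite cabsM cabs_real; apply: le_lt_trans hs; rewrite ler_wpM2l// lerDl.
  move: hv; rewrite lt_min => /andP[hr hd].
  rewrite mul0r addr0 Hr; last by rewrite addrC addKr.
  rewrite [z + _ - z]addrC addKr.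
  have -> : p (z + h%:C * v) * (h%:C * v) + q (z + h%:C * v) * cj (h%:C * v) - S z * h%:C
     = (S (z + h%:C * v) - S z) * h%:C.
    have -> : cj (h%:C * v) = h%:C * cj v by rewrite conjM; congr (_ * _); exact: conjc_real.
    rewrite /S; ring.
  rewrite cabsM cabs_real ler_wpM2r// ltW//; apply: Hd.
  by rewrite addrC addKr.
split; apply: eps_is_derive => e /K[s s0 Hs]; exists s => // h /Hs; apply: le_trans.
  have -> : complex.Re (S z) * (h - 0) = complex.Re (S z * (h - 0)%:C).
    by case: (S z) => x y /=; ring.
  by rewrite -!raddfB; exact: Re_le_cabs.
have -> : complex.Im (S z) * (h - 0) = complex.Im (S z * (h - 0)%:C).
  by case: (S z) => x y /=; ring.
by rewrite -!raddfB; exact: Im_le_cabs.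
Qed.

Lemma is_wirtinger_dx F z a b : is_wirtinger F z a b -> dx F z = a + b.
Proof.
move=> /(is_wirtinger_partial 1)[H1 H2].
have e1 : cj (1 : C) = 1 by rewrite /= oppr0.
rewrite e1 !mulr1 in H1 H2; rewrite /dx.
have -> : (fun h : R => complex.Re (F (z + h%:C))) = (fun h : R => complex.Re (F (z + h%:C * 1))).
  by apply/funext => h; rewrite mulr1.
have -> : (fun h : R => complex.Im (F (z + h%:C))) = (fun h : R => complex.Im (F (z + h%:C * 1))).
  by apply/funext => h; rewrite mulr1.
by rewrite !derive1E !derive_val; case: (a + b).
Qed.

Lemma is_wirtinger_dy F z a b : is_wirtinger F z a b -> dy F z = (0 +i* 1) * (a - b).
Proof.
move=> /(is_wirtinger_partial (0 +i* 1))[H1 H2].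
have E : a * (0 +i* 1) + b * cj (0 +i* 1) = (0 +i* 1) * (a - b) :> C.
  by rewrite /=; case: a b {H1 H2} => [x y] [x' y']; apply/eqP; rewrite eq_complex /=; apply/andP; split; apply/eqP; ring.
rewrite E in H1 H2; rewrite /dy.
have EE (h : R) : (0 +i* h : C) = h%:C * (0 +i* 1).
  by apply/eqP; rewrite eq_complex /=; apply/andP; split; apply/eqP; ring.
have -> : (fun h : R => complex.Re (F (z + h *i))) = (fun h : R => complex.Re (F (z + h%:C * (0 +i* 1)))).
  by apply/funext => h; rewrite EE.
have -> : (fun h : R => complex.Im (F (z + h *i))) = (fun h : R => complex.Im (F (z + h%:C * (0 +i* 1)))).
  by apply/funext => h; rewrite EE.
by rewrite !derive1E !derive_val; case: (_ * _).
Qed.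

Lemma is_wirtinger_wirtinger F z a b : is_wirtinger F z a b -> wirtinger F z = a.
Proof.
move=> H; rewrite /wirtinger (is_wirtinger_dx H) (is_wirtinger_dy H) mulrA.
have -> : (0 +i* 1) * (0 +i* 1) = -1 :> C.
  by apply/eqP; rewrite eq_complex /=; apply/andP; split; apply/eqP; ring.
by field.
Qed.

End Wirtinger.

(** * The Schwarzian derivative *)

Lemma det2_unit (K : fieldType) (M : 'M[K]_2) : M \in unitmx ->
  M ord0 ord0 * M ord_max ord_max - M ord0 ord_max * M ord_max ord0 != 0.
Proof.
rewrite unitmxE unitfE (expand_det_row _ ord0) !big_ord_recl big_ord0 addr0.
rewrite /cofactor !det_mx11 !mxE /= expr0 expr1 mul1r mulN1r mulrN.
set i := lift _ _; have -> : i = ord_max by apply/val_inj.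
have -> : lift ord_max 0 = ord0 :> 'I_2 by apply/val_inj.
by [].
Qed.

Section SchwarzianDerivative.
Variable R : realType.
Local Notation C := (cplx R).
Implicit Types (f g : C -> C) (z w : C).

Lemma is_cderive_eq f z d d' : d = d' -> is_cderive f z d -> is_cderive f z d'.
Proof. by move=> ->. Qed.

Lemma near_near z (P : C -> Prop) : (\forall w \near z, P w) ->
  \forall w \near z, \forall v \near w, P v.
Proof. by move=> /nbhs_interior. Qed.

(** The Schwarzian derivative as a function of the first three derivatives. *)
Definition schwarz_of_jet (f1 f2 f3 : C) : C := f3 / f1 - 3 / 2 * (f2 / f1) ^+ 2.

Lemma schwarzE f f1 f2 (f3 : C) z : f1 z != 0 ->
  (\forall w \near z, is_cderive f w (f1 w)) ->
  (\forall w \near z, is_cderive f1 w (f2 w)) -> is_cderive f2 z f3 ->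
  schwarz f z = schwarz_of_jet (f1 z) (f2 z) f3.
Proof.
move=> f1z H1 H2 H3.
have E1 : \forall w \near z, derive1 f w = f1 w.
  by apply: filterS H1 => w /is_cderiveP[_ ->].
have E2 : \forall w \near z, derive1 (derive1 f : C -> C) w = f2 w.
  apply: filterS2 (near_near E1) H2 => w Ew Hw.
  have : is_cderive (derive1 f : C -> C) w (f2 w).
    by apply: is_cderive_near Hw; apply: filterS Ew => v ->.
  by move=> /is_cderiveP[_ ->].
rewrite /schwarz (nbhs_singleton E1) (nbhs_singleton E2).
set q := fun w : C => _.
have : is_cderive q z (f3 * (f1 z)^-1 + f2 z * (- f2 z / f1 z ^+ 2)).
  have := is_cderiveM H3 (is_cderiveV f1z (nbhs_singleton H2)).
  by apply: is_cderive_near; apply: filterS2 E1 E2 => w; rewrite /q => -> ->.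
move=> /is_cderiveP[_ ->]; rewrite /schwarz_of_jet.
by field.
Qed.

Lemma schwarz_near f g z : (\forall w \near z, f w = g w) -> schwarz f z = schwarz g z.
Proof.
move=> fg.
have E f' g' w : (\forall v \near w, f' v = g' v) -> derive1 f' w = derive1 g' w.
  move=> fg'; rewrite !derive1E; apply: near_eq_derive; exact: fg'.
have E1 : \forall w \near z, derive1 f w = derive1 g w.
  by apply: filterS (near_near fg) => w; exact: E.
have E2 : \forall w \near z, derive1 (derive1 f : C -> C) w = derive1 (derive1 g : C -> C) w.
  by apply: filterS (near_near E1) => w; exact: E.
pose qf (w : C) : C := derive1 (derive1 f : C -> C) w / derive1 f w.
pose qg (w : C) : C := derive1 (derive1 g : C -> C) w / derive1 g w.
have E3 : \forall w \near z, qf w = qg w.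
  apply: filterS2 E1 E2 => w e1 e2.
  exact: (f_equal2 (fun u v : C => v / u) e1 e2).
have e3 : qf z = qg z := nbhs_singleton E3.
have e4 : derive1 qf z = derive1 qg z by exact: E.
change (derive1 qf z - qf z ^+ 2 / 2 = derive1 qg z - qg z ^+ 2 / 2).
exact: (f_equal2 (fun u v : C => u - v ^+ 2 / 2) e4 e3).
Qed.

(** With [V = (c g + d)^-1] and [k = a d - b c] the successive derivatives of the
    composite are polynomials in [V], the first one being [k g' V^2]. The terms
    in [V] cancel in the Schwarzian derivative. *)
Lemma schwarz_homography (a b c d : C) g g1 g2 (g3 : C) z : a * d - b * c != 0 ->
  c * g z + d != 0 -> g1 z != 0 ->
  (\forall w \near z, is_cderive g w (g1 w)) ->
  (\forall w \near z, is_cderive g1 w (g2 w)) -> is_cderive g2 z g3 ->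
  schwarz (fun w => (a * g w + b) / (c * g w + d)) z = schwarz_of_jet (g1 z) (g2 z) g3.
Proof.
move=> det0 L0 g1z H1 H2 H3.
pose L w := c * g w + d; pose V w := (L w)^-1; pose k := a * d - b * c.
have HL w : is_cderive g w (g1 w) -> is_cderive L w (c * g1 w).
  move=> Hw; apply: (@is_cderive_eq _ _ (c * g1 w + 0)); first by rewrite addr0.
  by apply: is_cderiveD; [exact: is_cderiveZ|exact: is_cderive_cst].
have HV w : L w != 0 -> is_cderive g w (g1 w) -> is_cderive V w (- c * g1 w * V w ^+ 2).
  move=> Lw /HL /(is_cderiveV Lw); apply: is_cderive_eq.
  by rewrite /V; field.
have Lnear : \forall w \near z, L w != 0.
  by apply: continuous_neq0 => //; exact: is_cderive_continuous (HL _ (nbhs_singleton H1)).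
pose h1 w := k * (g1 w * (V w * V w)).
pose h2 w := k * (g2 w * (V w * V w) - 2 * c * (g1 w * g1 w * (V w * V w * V w))).
pose h3 := k * (g3 * V z ^+ 2 - 6 * c * g1 z * g2 z * V z ^+ 3 + 6 * c ^+ 2 * g1 z ^+ 3 * V z ^+ 4).
have Vz : V z != 0 by rewrite invr_neq0.
rewrite (@schwarzE _ h1 h2 h3).
- rewrite /schwarz_of_jet /h1 /h2 /h3; field.
  by rewrite Vz g1z.
- by rewrite /h1 !mulf_neq0.
- apply: filterS2 H1 Lnear => w Hw Lw.
  have Hn : is_cderive (fun w => a * g w + b) w (a * g1 w + 0).
    by apply: is_cderiveD; [exact: is_cderiveZ|exact: is_cderive_cst].
  apply: is_cderive_eq (is_cderiveM Hn (HV w Lw Hw)).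
  by rewrite /h1 /k /V /L; field.
- apply: filterS3 H1 H2 Lnear => w Hw H2w Lw.
  have HVw := HV w Lw Hw.
  apply: is_cderive_eq (is_cderiveZ k (is_cderiveM H2w (is_cderiveM HVw HVw))).
  by rewrite /h2; ring.
have HVz := HV z L0 (nbhs_singleton H1); have H2z := nbhs_singleton H2.
have T1 := is_cderiveM H3 (is_cderiveM HVz HVz).
have T2 := is_cderiveM (is_cderiveM H2z H2z) (is_cderiveM (is_cderiveM HVz HVz) HVz).
apply: is_cderive_eq (is_cderiveZ k (is_cderiveB T1 (is_cderiveZ (2 * c) T2))).
by rewrite /h3; ring.
Qed.

(** At a pole the homography is inverted, which exchanges the rows of [M]; the
    numerator does not vanish there because [M] is invertible. So both cases
    reduce to [schwarz_homography]. *)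
Lemma schwarzian_mobius (M : 'M[C]_2) (f : C -> option C) g g1 g2 (g3 : C) z : M \in unitmx ->
  (\forall w \near z, f w = mobius M (g w)) -> g1 z != 0 ->
  (\forall w \near z, is_cderive g w (g1 w)) ->
  (\forall w \near z, is_cderive g1 w (g2 w)) -> is_cderive g2 z g3 ->
  schwarzian f z = schwarz_of_jet (g1 z) (g2 z) g3.
Proof.
move=> /det2_unit det0 fM g1z H1 H2 H3.
set a := M ord0 ord0 in det0; set b := M ord0 ord_max in det0.
set c := M ord_max ord0 in det0; set d := M ord_max ord_max in det0.
have cg := is_cderive_continuous (nbhs_singleton H1).
have cL p q : {for z, continuous (fun w => p * g w + q)}.
  exact: (ccontD (ccontM (ccont_cst p z) cg) (ccont_cst q z)).
rewrite /schwarzian (nbhs_singleton fM) /mobius -/a -/b -/c -/d.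
case: eqP => [L0|/eqP L0].
- have N0 : a * g z + b != 0.
    apply: contraNneq det0 => N0; have -> : a * d - b * c = a * (c * g z + d) - c * (a * g z + b) by ring.
    by rewrite L0 N0 !mulr0 subrr.
  have Nn := continuous_neq0 (cL a b) N0.
  have det0' : c * b - d * a != 0.
    by rewrite -oppr_eq0 opprB [d * a]mulrC [c * b]mulrC.
  rewrite -(schwarz_homography det0' N0 g1z H1 H2 H3); apply: schwarz_near.
  apply: filterS2 fM Nn => w -> Nw; rewrite /mobius -/a -/b -/c -/d.
  have [-> /=|Lw] := eqVneq (c * g w + d) 0; first by rewrite mul0r.
  by rewrite /inv_cp1 mulf_eq0 invr_eq0 (negbTE Nw) (negbTE Lw) /= invf_div.
rewrite -(schwarz_homography det0 L0 g1z H1 H2 H3); apply: schwarz_near.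
apply: filterS2 fM (continuous_neq0 (cL c d) L0) => w -> Lw.
by rewrite /mobius -/a -/b -/c -/d (negbTE Lw).
Qed.

End SchwarzianDerivative.

(** * Moebius maps from the disk onto the half-plane *)

Section HalfPlane.
Variable R : realType.
Local Notation C := (cplx R).
Local Notation D := (@disk R).
Local Notation H := (@halfplane R).
Implicit Types (a b c d z w : C) (x y : R).

(** The imaginary part of [(a z + b) / (c z + d)] times [|c z + d|^2]. *)
Definition height a b c d z : R := complex.Im ((a * z + b) * conjc (c * z + d)).

Lemma heightE a b c d z : height a b c d z =
  complex.Im (a * conjc c) * cabs z ^+ 2 + complex.Im ((a * conjc d - conjc b * c) * z)
  + complex.Im (b * conjc d).
Proof.
by rewrite /height cabs_sqr; case: a b c d z => [? ?] [? ?] [? ?] [? ?] [? ?] /=; ring.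
Qed.

Lemma det_height a b c d : cabs (a * d - b * c) ^+ 2 =
  cabs (a * conjc d - conjc b * c) ^+ 2 - 4 * complex.Im (a * conjc c) * complex.Im (b * conjc d).
Proof.
by rewrite !cabs_sqr; case: a b c d => [? ?] [? ?] [? ?] [? ?] /=; ring.
Qed.

Lemma Im_div z w : w != 0 -> complex.Im (z / w) * cabs w ^+ 2 = complex.Im (z * conjc w).
Proof.
rewrite -cabs_eq0 -(sqrf_eq0 (cabs w)) cabs_sqr; case: z w => [x y] [u v] /= w0.
by field.
Qed.

(** The limit of a polynomial inequality at [t = 1], made explicit: for a negative
    limit [- e], the value at [1 - s] is still negative when [s m <= e]. *)
Lemma quadratic_limit (P q S : R) : (forall t, 0 <= t < 1 -> 0 < P * t ^+ 2 + q * t + S) ->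
  0 <= P + q + S.
Proof.
move=> Ht; rewrite leNgt; apply/negP => neg.
pose e := - (P + q + S); have e0 : 0 < e by rewrite oppr_gt0.
pose m := `|2 * P + q| + `|P| + 1.
have m1 : 1 <= m by rewrite lerDr addr_ge0.
have m0 : 0 < m := lt_le_trans ltr01 m1.
pose s := e / (m * (1 + e)).
have e1 : 0 < 1 + e by lra.
have s0 : 0 < s by rewrite divr_gt0// mulr_gt0.
have sme : s * m = e / (1 + e).
  have F (u v t : R) : u != 0 -> v != 0 -> t / (u * v) * u = t / v.
    by move=> u0 v0; field; rewrite u0 v0.
  by apply: F; exact: lt0r_neq0.
have sm : s * m < 1 by rewrite sme ltr_pdivrMr// mul1r; lra.
have s1 : s < 1.
  by apply: le_lt_trans sm; rewrite ler_pMr.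
clearbody s.
have := Ht (1 - s) _; rewrite subr_ge0 (ltW s1) gtrBl s0 => /(_ isT).
have -> : P * (1 - s) ^+ 2 + q * (1 - s) + S = - e - s * (2 * P + q) + P * s * s.
  by rewrite /e; ring.
have B1 : - (s * (2 * P + q)) <= s * `|2 * P + q|.
  by rewrite -mulrN ler_pM2l// -normrN ler_norm.
have B2 : P * s * s <= s * `|P|.
  apply: (@le_trans _ _ (`|P| * s * s)).
    have ss : 0 <= s * s by rewrite mulr_ge0// ltW.
    by rewrite -!mulrA; exact: (ler_wpM2r ss (ler_norm P)).
  have sl : `|P| * s <= `|P| by rewrite ler_piMr// ltW.
  by rewrite mulrC; exact: (ler_wpM2l (ltW s0) sl).
have B3 : s * m <= e.
  by rewrite sme ler_pdivrMr// ler_pMr//; lra.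
rewrite /m !mulrDr mulr1 in B3; lra.
Qed.

(** The height is a real quadratic polynomial in [z], positive on the disk. It is
    nonnegative on the circle by continuity, and it cannot be positive there:
    the value at such a point would be in the half-plane, hence attained inside
    the disk, against injectivity. Vanishing at [1], [-1], [i] and [-i] forces it
    to be [S (1 - |z|^2)], and [det_height] then yields the determinant. This is
    the equality case of the Schwarz-Pick lemma. *)
Lemma disk_to_halfplane (M : 'M[C]_2) (A : C -> C) :
  let a := M ord0 ord0 in let b := M ord0 ord_max in
  let c := M ord_max ord0 in let d := M ord_max ord_max in
  M \in unitmx -> (forall z, D z -> mobius M z = Some (A z)) -> A @` D = H ->
  (forall z, D z -> c * z + d != 0 /\ A z = (a * z + b) / (c * z + d)) /\
  exists S : R, [/\ 0 < S, cabs (a * d - b * c) = 2 * S &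
    forall z, D z -> complex.Im (A z) * cabs (c * z + d) ^+ 2 = S * (1 - cabs z ^+ 2)].
Proof.
move=> a b c d /det2_unit; rewrite -/a -/b -/c -/d => det0 HM AH.
have HA z : D z -> c * z + d != 0 /\ A z = (a * z + b) / (c * z + d).
  move=> /HM; rewrite /mobius -/a -/b -/c -/d; case: eqP => // /eqP L0 [<-].
  by split.
have Hpos z : D z -> 0 < complex.Im (A z).
  move=> Dz; have : (A @` D) (A z) by exists z.
  by rewrite AH.
split => //.
have Nz z : D z -> complex.Im (A z) * cabs (c * z + d) ^+ 2 = height a b c d z.
  by move=> /HA[L0 ->]; rewrite Im_div.
have Npos z : D z -> 0 < height a b c d z.
  move=> Dz; rewrite -Nz// mulr_gt0 ?Hpos// exprn_gt0// cabs_gt0.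
  by have [] := HA z Dz.
set P := complex.Im (a * conjc c); set q := a * conjc d - conjc b * c.
pose S := complex.Im (b * conjc d).
have Hb z : cabs z = 1 -> height a b c d z = 0.
  move=> z1; apply/eqP; rewrite eq_le; apply/andP; split.
    rewrite leNgt; apply/negP => N0.
    have L0 : c * z + d != 0.
      by apply: contraTneq N0 => L0; rewrite /height L0 raddf0 mulr0 ltxx.
    have : H ((a * z + b) / (c * z + d)).
      rewrite /H /= -(pmulr_lgt0 _ (_ : 0 < cabs (c * z + d) ^+ 2)).
        by rewrite Im_div.
      by rewrite exprn_gt0// cabs_gt0.
    rewrite -AH => -[w Dw]; have [Lw ->] := HA w Dw.
    move=> /eqP; rewrite eqr_div// => /eqP E.
    have : (a * d - b * c) * (w - z) = 0.
      have -> : (a * d - b * c) * (w - z) = (a * w + b) * (c * z + d) - (a * z + b) * (c * w + d) by ring.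
      by rewrite E subrr.
    move=> /eqP; rewrite mulf_eq0 (negbTE det0) subr_eq0 => /eqP wz.
    by move: Dw; rewrite wz /disk /= z1 ltxx.
  rewrite heightE z1 expr1n mulr1; apply: quadratic_limit => t /andP[t0 t1].
  have Dt : D (t%:C * z).
    by rewrite /disk /= cabsM cabs_real z1 mulr1 ger0_norm.
  have := Npos _ Dt; rewrite heightE cabsM cabs_real z1 mulr1 ger0_norm//.
  rewrite -/P -/q -/S.
  have -> : complex.Im (q * (t%:C * z)) = complex.Im (q * z) * t.
    by case: (q) (z) => [? ?] [? ?] /=; ring.
  by [].
have n1 : cabs (1 : C) = 1 by rewrite /= expr0n expr1n addr0 sqrtr1.
have ni : cabs (0 +i* 1 : C) = 1 by rewrite /= expr0n expr1n add0r sqrtr1.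
have := Hb 1 n1; have := Hb (- 1); rewrite cabsN => /(_ n1).
have := Hb (0 +i* 1) ni; have := Hb (- (0 +i* 1)); rewrite cabsN => /(_ ni).
rewrite !heightE !cabsN n1 ni expr1n mulr1 -/P -/q -/S.
case Eq : q => [q1 q2] /= h1 h2 h3 h4.
have PS : P = - S by lra.
have q0 : q = 0 by rewrite Eq; apply/eqP; rewrite eq_complex /=; apply/andP; split; apply/eqP; lra.
have D0 : D 0 by change (cabs (0 : C) < 1); rewrite cabs0.
have HN z : height a b c d z = S * (1 - cabs z ^+ 2).
  by rewrite heightE -/P -/q -/S q0 mul0r PS /=; ring.
have S0 : 0 < S by have := Npos 0 D0; rewrite HN cabs0 expr0n subr0 mulr1.
exists S; split => //; last by move=> z Dz; rewrite Nz.
apply/eqP; rewrite -(@eqrXn2 _ 2)// ?cabs_ge0 ?mulr_ge0 ?ltW//.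
rewrite det_height -/P -/q -/S q0 cabs0 PS; apply/eqP; ring.
Qed.

(** Both sides are functions of the hyperbolic distance between the two points,
    computed in the half-plane and in the disk. *)
Lemma mobius_isometry (M : 'M[C]_2) (A : C -> C) :
  M \in unitmx -> (forall z, D z -> mobius M z = Some (A z)) -> A @` D = H ->
  forall z w, D z -> D w ->
  cabs (A z - A w) ^+ 2 / (complex.Im (A z) * complex.Im (A w)) =
  4 * cabs (z - w) ^+ 2 / ((1 - cabs z ^+ 2) * (1 - cabs w ^+ 2)).
Proof.
move=> uM HM AH z w Dz Dw.
have [HA [S [S0 HS HI]]] := disk_to_halfplane uM HM AH.
move: (M ord0 ord0) (M ord0 ord_max) (M ord_max ord0) (M ord_max ord_max) HA HS HI.
move=> a b c d HA HS HI.
have := HI z Dz; have := HI w Dw.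
have [Lz Ez] := HA z Dz; have [Lw Ew] := HA w Dw.
have E : A z - A w = (a * d - b * c) * (z - w) / ((c * z + d) * (c * w + d)).
  by rewrite Ez Ew; field; rewrite Lz Lw.
rewrite E !cabsM cabsV cabsM HS.
have {}Lz : 0 < cabs (c * z + d) by rewrite cabs_gt0.
have {}Lw : 0 < cabs (c * w + d) by rewrite cabs_gt0.
have z1 : 0 < 1 - cabs z ^+ 2 by rewrite subr_gt0 expr_lt1 ?cabs_ge0.
have w1 : 0 < 1 - cabs w ^+ 2 by rewrite subr_gt0 expr_lt1 ?cabs_ge0.
move: (cabs (c * z + d)) (cabs (c * w + d)) (complex.Im (A z)) (complex.Im (A w)) Lz Lw.
move: (1 - cabs z ^+ 2) (1 - cabs w ^+ 2) z1 w1 => u v u0 v0 p q Iz Iw p0 q0 Hw Hz.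
have -> : Iz = S * u / p ^+ 2 by rewrite -Hz mulfK// expf_neq0// gt_eqF.
have -> : Iw = S * v / q ^+ 2 by rewrite -Hw mulfK// expf_neq0// gt_eqF.
by field; rewrite !gt_eqF//.
Qed.

Variable pi : groupType.

(** In the half-plane the translation is [w |-> m w] with [m > 1], and the
    invariant of [w] and [m w] is [k |w|^2 / (Im w)^2] with [k = (m - 1)^2 / m].
    It is least exactly on the imaginary axis. So [k] and the axis are seen in
    the disk, without reference to [A]. *)
Lemma normalizes_dilation (h : pi -> C -> C) (c : pi) (A : C -> C) :
  h c @` D = D -> normalizes h c A ->
  exists2 k : R, 0 < k & [/\
    exists2 z, D z & 4 * cabs (z - h c z) ^+ 2 / ((1 - cabs z ^+ 2) * (1 - cabs (h c z) ^+ 2)) = k,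
    forall z, D z -> k <= 4 * cabs (z - h c z) ^+ 2 / ((1 - cabs z ^+ 2) * (1 - cabs (h c z) ^+ 2)) &
    forall z, D z -> (4 * cabs (z - h c z) ^+ 2 / ((1 - cabs z ^+ 2) * (1 - cabs (h c z) ^+ 2)) = k)
      <-> complex.Re (A z) = 0].
Proof.
move=> hD [[M uM HM] AH [l l0 Hl]].
have Dh z : D z -> D (h c z) by move=> Dz; rewrite -hD; exists z.
pose m := expR l; have m1 : 1 < m by rewrite /m expR_gt1.
have m0 : 0 < m := lt_trans ltr01 m1.
pose k := (m - 1) ^+ 2 / m.
have k0 : 0 < k by rewrite divr_gt0// exprn_gt0// subr_gt0.
have Ipos z : D z -> 0 < complex.Im (A z).
  by move=> Dz; have : (A @` D) (A z) by [exists z]; rewrite AH.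
have E z : D z -> 4 * cabs (z - h c z) ^+ 2 / ((1 - cabs z ^+ 2) * (1 - cabs (h c z) ^+ 2)) =
    k * (1 + complex.Re (A z) ^+ 2 / complex.Im (A z) ^+ 2).
  move=> Dz; rewrite -(mobius_isometry uM HM AH Dz (Dh _ Dz)) Hl// -/m cabs_sqr.
  have := Ipos z Dz; case: (A z) => x y /= y0; rewrite /k.
  by field; rewrite !gt_eqF//.
exists k => //; split.
- have : H (0 +i* 1) by rewrite /halfplane /=.
  rewrite -AH => -[z Dz Az]; exists z => //.
  by rewrite E// Az /= expr0n mul0r addr0 mulr1.
- by move=> z Dz; rewrite E// ler_peMr ?(ltW k0)// lerDl divr_ge0// sqr_ge0.
- move=> z Dz; rewrite E//; split; last by move=> ->; rewrite expr0n mul0r addr0 mulr1.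
  move=> /eqP; rewrite -subr_eq0 mulrDr mulr1 addrAC subrr add0r.
  rewrite mulf_eq0 (gt_eqF k0) mulf_eq0 invr_eq0 !expf_eq0 /= (gt_eqF (Ipos z Dz)) orbF.
  by move=> /eqP.
Qed.

(** Two normalizations of one curve give the same least displacement, hence the
    same points where it is attained. *)
Lemma axis_normalizes (h : pi -> C -> C) (c : pi) (A : C -> C) p :
  h c @` D = D -> normalizes h c A -> axis h c p -> complex.Re (A p) = 0.
Proof.
move=> hD nA [Dp [A' nA' Rp]].
have [k k0 [[z Dz Ez] lek eqk]] := normalizes_dilation hD nA.
have [k' k'0 [[z' Dz' Ez'] lek' eqk']] := normalizes_dilation hD nA'.
apply/(eqk p Dp); rewrite (proj2 (eqk' p Dp) Rp).
by apply/eqP; rewrite eq_le; apply/andP; split; [rewrite -Ez; exact: lek'|rewrite -Ez'; exact: lek].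
Qed.

End HalfPlane.

(** * Null sets of the plane *)

Section NullSets.
Variable R : realType.
Local Notation C := (cplx R).
Local Notation mu := (@lebesgue_measure R).
Local Notation mu2 := (mu \x mu)%E.
Implicit Types (p : R * R) (e : R).

Definition box p e : set (R * R) := [set q | `|q.1 - p.1| < e /\ `|q.2 - p.2| < e].

Let ratbox (q : rat * rat * rat * rat) : set (R * R) :=
  [set p | ratr q.1.1.1 < p.1 < ratr q.1.1.2 /\ ratr q.1.2 < p.2 < ratr q.2].

Let measurable_ratbox q : measurable (ratbox q).
Proof.
rewrite (_ : ratbox q = `]ratr q.1.1.1, ratr q.1.1.2[%classic `*` `]ratr q.1.2, ratr q.2[%classic).
  exact: measurableX.
by apply/seteqP; split => p /=; rewrite !in_itv.
Qed.

Let ratbox_in p e : 0 < e -> exists2 q, ratbox q p & ratbox q `<=` box p e.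
Proof.
move=> e0.
have L (x : R) : exists r : rat, x - e < ratr r < x.
  have /rat_in_itvoo[r] : x - e < x by rewrite gtrBl.
  by rewrite in_itv; exists r.
have U (x : R) : exists r : rat, x < ratr r < x + e.
  have /rat_in_itvoo[r] : x < x + e by rewrite ltrDl.
  by rewrite in_itv; exists r.
have [[q1 /andP[a1 b1]] [q2 /andP[a2 b2]]] := (L p.1, U p.1).
have [[q3 /andP[a3 b3]] [q4 /andP[a4 b4]]] := (L p.2, U p.2).
exists (q1, q2, q3, q4); first by rewrite /ratbox /= b1 a2 b3 a4.
move=> x [/andP[x1 x2] /andP[x3 x4]]; rewrite /box /= in x1 x2 x3 x4 *.
by split; rewrite ltr_norml; lra.
Qed.

Let countable_union (T : countType) (N : T -> set (R * R)) :
  \bigcup_q N q = \bigcup_(n : nat) (if unpickle n is Some q then N q else set0).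
Proof.
apply/seteqP; split => x.
  by case=> q _ Nx; exists (pickle q) => //; rewrite pickleK.
by case=> n _; case: unpickle => // q Nx; exists q.
Qed.

(** An open set is the union of the countably many boxes with rational vertices
    that it contains. *)
Lemma open_box_measurable (O : set (R * R)) :
  (forall p, O p -> exists2 e, 0 < e & box p e `<=` O) -> measurable O.
Proof.
move=> HO.
have -> : O = \bigcup_q [set p | ratbox q `<=` O /\ ratbox q p].
  apply/seteqP; split => p.
    move=> /HO[e e0 He]; have [q qp qe] := ratbox_in p e0.
    by exists q => //; split => //; apply: subset_trans He.
  by case=> q _ [qO qp]; exact: qO.
rewrite countable_union; apply: bigcupT_measurable => n.
case: unpickle => [q|]; last exact: measurable0.
have [qO|qO] := pselect (ratbox q `<=` O).
  rewrite (_ : [set p | _] = ratbox q); first exact: measurable_ratbox.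
  by apply/seteqP; split => p //; case.
rewrite (_ : [set p | _] = set0); first exact: measurable0.
by apply/seteqP; split => p //; case.
Qed.

Lemma negligible2S (A B : set (R * R)) : B `<=` A -> mu2.-negligible A -> mu2.-negligible B.
Proof. by move=> AB; exact: (@negligibleS _ _ _ mu2 _ _ AB). Qed.

(** Lindelof's argument: countably many rational boxes with null trace on [B]
    cover [B]. *)
Lemma locally_negligible (B : set (R * R)) :
  (forall p, B p -> exists2 e, 0 < e & mu2.-negligible (B `&` box p e)) ->
  mu2.-negligible B.
Proof.
move=> HB.
pose N q : set (R * R) := [set p | mu2.-negligible (B `&` ratbox q) /\ (B `&` ratbox q) p].
have sub : B `<=` \bigcup_q N q.
  move=> p Bp; have [e e0 He] := HB p Bp; have [q qp qe] := ratbox_in p e0.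
  by exists q => //; split => //; apply: negligible2S He; exact: setIS.
apply: (negligible2S sub); rewrite countable_union; apply: (@negligible_bigcup _ _ _ mu2) => n.
case: unpickle => [q|]; last exact: (@negligible_set0 _ _ _ mu2).
have [H|H] := pselect (mu2.-negligible (B `&` ratbox q)).
  by apply: negligible2S H => p [].
by apply: negligible2S (@negligible_set0 _ _ _ mu2) => p [].
Qed.

Let mu_sub1 (A : set R) (y : R) : A `<=` [set y] -> mu A = 0%E.
Proof.
move=> Ay; have [->|An0] := eqVneq A set0; first exact: measure0.
have -> : A = [set y].
  apply/seteqP; split => // _ ->; move/set0P: An0 => [x Ax].
  by rewrite -(Ay x Ax).
exact: lebesgue_measure_set1.
Qed.

(** By Fubini's theorem, in either order: all slices in one direction have at most
    one point. *)
Lemma slices_negligible (Z : set (R * R)) : measurable Z ->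
  (forall x y y', Z (x, y) -> Z (x, y') -> y = y') \/
  (forall y x x', Z (x, y) -> Z (x', y) -> x = x') -> mu2.-negligible Z.
Proof.
move=> mZ; case=> inj; apply/negligibleP => //.
  rewrite [LHS]integral0_eq// => x _ /=.
  have [[y Zy]|nZ] := pselect (exists y, Z (x, y)).
    by apply: (@mu_sub1 _ y) => y'; rewrite /xsection /= inE => Zy'; exact: inj Zy' Zy.
  rewrite (_ : xsection Z x = set0) ?measure0//.
  by apply/seteqP; split => // y; rewrite /xsection /= inE => Zy; apply: nZ; exists y.
transitivity ((mu \x^ mu)%E Z).
  apply: (@product_measure_unique _ _ _ _ _ mu mu (mu \x^ mu)%E) => // A B mA mB.
  by rewrite /= product_measure2E.
- rewrite [LHS]integral0_eq// => y _ /=.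
  have [[x Zx]|nZ] := pselect (exists x, Z (x, y)).
    by apply: (@mu_sub1 _ x) => x'; rewrite /ysection /= inE => Zx'; exact: inj Zx' Zx.
  rewrite (_ : ysection Z y = set0) ?measure0//.
  by apply/seteqP; split => // x; rewrite /ysection /= inE => Zx; apply: nZ; exists x.
Qed.

(** Rolle's theorem. *)
Let slice_inj (W W' : C -> C) (u v : C) (s t : R) : s < t ->
  (forall r, s <= r <= t -> is_cderive W (u + r%:C * v) (W' (u + r%:C * v))) ->
  (forall r, s <= r <= t -> complex.Im (W' (u + r%:C * v) * v) != 0) ->
  complex.Im (W (u + s%:C * v)) != complex.Im (W (u + t%:C * v)).
Proof.
move=> st HW Hn; apply/eqP => E.
have [||r] := @MVT_segment R (fun r : R => complex.Im (W (u + r%:C * v)))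
    (fun r : R => complex.Im (W' (u + r%:C * v) * v)) s t (ltW st).
- move=> r; rewrite in_itv /= => /andP[r0 r1].
  by apply: (is_derive_line _).2; apply: HW; rewrite !ltW.
- apply: derivable_within_continuous => r; rewrite in_itv /= => ri.
  by have [] := (is_derive_line (HW r ri)).2.
rewrite in_itv /= => ri; rewrite E subrr => /esym/eqP.
by rewrite mulf_eq0 (negbTE (Hn r ri)) subr_eq0 (gt_eqF st).
Qed.

(** The partial derivatives of [Im W] are [Im W'] and [Re W'], and one of them is
    nonzero, hence of constant sign near [z0]. So [Im W] is injective on the
    slices of a small box in that direction. The box does not depend on the
    level [t], which allows several levels to be treated at once. *)
Lemma level_negligible (W W' : C -> C) (z0 : C) :
  (\forall w \near z0, is_cderive W w (W' w)) -> {for z0, continuous W'} -> W' z0 != 0 ->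
  exists2 e, 0 < e & forall t, mu2.-negligible
    [set p | box (complex.Re z0, complex.Im z0) e p /\ complex.Im (W (p.1 +i* p.2)) = t].
Proof.
move=> /nbhs_cabsP[r r0 HW] /continuous_cabsP cW W0.
pose p0 : R * R := (complex.Re z0, complex.Im z0).
pose pt p : C := p.1 +i* p.2.
have ptb e p : 0 < e -> box p0 (e / 2) p -> cabs (pt p - z0) < e.
  move=> e0 [/= h1 h2]; rewrite (splitr e); apply: le_lt_trans (cabs_le_ReIm _) _.
  by case: z0 @p0 h1 h2 {HW cW W0} => a b /= h1 h2; exact: ltrD.
have meas e t : 0 < e -> e <= r ->
    measurable [set p | box p0 (e / 2) p /\ complex.Im (W (pt p)) = t].
  move=> e0 er.
  have mb : measurable (box p0 (e / 2)).
    apply: open_box_measurable => p [h1 h2].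
    exists (Order.min (e / 2 - `|p.1 - p0.1|) (e / 2 - `|p.2 - p0.2|)).
      by rewrite lt_min !subr_gt0 h1.
    move=> q [/=]; rewrite !lt_min => /andP[q1 _] /andP[_ q2]; split => /=.
      have -> : q.1 - p0.1 = (q.1 - p.1) + (p.1 - p0.1) by rewrite addrA subrK.
      by apply: (le_lt_trans (ler_normD _ _)); lra.
    have -> : q.2 - p0.2 = (q.2 - p.2) + (p.2 - p0.2) by rewrite addrA subrK.
    by apply: (le_lt_trans (ler_normD _ _)); lra.
  (* The level set is measurable as the difference of two open sets. *)
  rewrite (_ : [set p | _] = box p0 (e / 2) `\` [set p | cabs (pt p - z0) < e /\ complex.Im (W (pt p)) != t]).
    apply: measurableD => //; apply: open_box_measurable => p [p1 pt0].
    have := HW (pt p) (lt_le_trans p1 er) => /is_cderive_continuous/continuous_cabsP.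
    move=> /(_ `|complex.Im (W (pt p)) - t|); rewrite normr_gt0 subr_eq0 => /(_ pt0)[d d0 Hd].
    pose k := Order.min d (e - cabs (pt p - z0)).
    have k0 : 0 < k by rewrite lt_min d0 subr_gt0.
    exists (k / 2); first by rewrite divr_gt0.
    move=> q [q1 q2].
    have qp : cabs (pt q - pt p) < k.
      by rewrite (splitr k); apply: le_lt_trans (cabs_le_ReIm _) _; exact: ltrD.
    move: qp; rewrite lt_min => /andP[qd qe]; split => /=.
      have -> : pt q - z0 = (pt q - pt p) + (pt p - z0) by rewrite addrA subrK.
      by apply: (le_lt_trans (ler_cabsD _ _)); lra.
    apply/eqP => Et; have := Hd _ qd; rewrite -Et distrC -raddfB => h.
    by have := lt_le_trans h (Im_le_cabs _); rewrite ltxx.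
  apply/seteqP; split => p /=.
    by move=> [h1 ->]; split => //; rewrite eqxx => -[].
  by move=> [h1 h2]; split => //; apply/eqP/negP => /negP h; apply: h2; split => //; exact: ptb.
have [Re0|Im0] : complex.Re (W' z0) != 0 \/ complex.Im (W' z0) != 0.
- apply/orP; rewrite -negb_and; apply: contraNN W0.
  by case: (W' z0) => a b /= /andP[/eqP-> /eqP->].
- have [d d0 Hd] := cW _ (eq_ind_r is_true Re0 (normr_gt0 (complex.Re (W' z0)))).
  pose e := Order.min r d; have e0 : 0 < e by rewrite lt_min r0.
  have er : e <= r by rewrite ge_min lexx.
  exists (e / 2); first by rewrite divr_gt0.
  move=> t; apply: slices_negligible; first exact: meas.
  left => x; suff K y y' : y < y' -> box p0 (e / 2) (x, y) -> box p0 (e / 2) (x, y') ->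
      complex.Im (W (x +i* y)) != complex.Im (W (x +i* y')).
    move=> y y' [b1 E1] [b2 E2]; apply/eqP; case: (ltgtP y y') => // yy.
      by have := K _ _ yy b1 b2; rewrite E1 E2 eqxx.
    by have := K _ _ yy b2 b1; rewrite E1 E2 eqxx.
  move=> yy [/= bx b1] [_ /= b2].
  have E s : x%:C + s%:C * (0 +i* 1) = x +i* s :> C.
    by apply/eqP; rewrite eq_complex /=; apply/andP; split; apply/eqP; ring.
  have Hs s : y <= s <= y' -> cabs ((x +i* s : C) - z0) < e.
    move=> /andP[s1 s2]; apply: (ptb e (x, s) e0); split => //=.
    by move: b1 b2; rewrite !ltr_norml; lra.
  have := @slice_inj W W' x%:C (0 +i* 1) y y' yy; rewrite !E; apply => s si; rewrite E.
    by apply: HW; apply: lt_le_trans (Hs _ si) er.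
  have -> : complex.Im (W' (x +i* s) * (0 +i* 1)) = complex.Re (W' (x +i* s)).
    by case: (W' _) => ? ? /=; ring.
  have := Hd _ (lt_le_trans (Hs _ si) (_ : e <= d)); rewrite ge_min lexx orbT => /(_ isT).
  move=> /(le_lt_trans (Re_le_cabs _)); apply: contraTneq; rewrite raddfB /= => ->.
  by rewrite sub0r normrN ltxx.
have [d d0 Hd] := cW _ (eq_ind_r is_true Im0 (normr_gt0 (complex.Im (W' z0)))).
pose e := Order.min r d; have e0 : 0 < e by rewrite lt_min r0.
have er : e <= r by rewrite ge_min lexx.
exists (e / 2); first by rewrite divr_gt0.
move=> t; apply: slices_negligible; first exact: meas.
right => y; suff K x x' : x < x' -> box p0 (e / 2) (x, y) -> box p0 (e / 2) (x', y) ->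
    complex.Im (W (x +i* y)) != complex.Im (W (x' +i* y)).
  move=> x x' [b1 E1] [b2 E2]; apply/eqP; case: (ltgtP x x') => // yy.
    by have := K _ _ yy b1 b2; rewrite E1 E2 eqxx.
  by have := K _ _ yy b2 b1; rewrite E1 E2 eqxx.
move=> yy [/= b1 by_] [/= b2 _].
have E s : (0 +i* y) + s%:C * 1 = s +i* y :> C.
  by apply/eqP; rewrite eq_complex /=; apply/andP; split; apply/eqP; ring.
have Hs s : x <= s <= x' -> cabs ((s +i* y : C) - z0) < e.
  move=> /andP[s1 s2]; apply: (ptb e (s, y) e0); split => //=.
  by move: b1 b2; rewrite !ltr_norml; lra.
have := @slice_inj W W' (0 +i* y) 1 x x' yy; rewrite !E; apply => s si; rewrite E.
  by apply: HW; apply: lt_le_trans (Hs _ si) er.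
rewrite mulr1.
have := Hd _ (lt_le_trans (Hs _ si) (_ : e <= d)); rewrite ge_min lexx orbT => /(_ isT).
move=> /(le_lt_trans (Im_le_cabs _)); apply: contraTneq; rewrite raddfB /= => ->.
by rewrite sub0r normrN ltxx.
Qed.

End NullSets.

(** * Schwarzian tensors and Hopf differentials *)

Section Densities.
Variable R : realType.
Local Notation C := (cplx R).
Local Notation cj := (conjc : C -> C).
Local Notation D := (@disk R).
Implicit Types (k g : C -> C) (z w : C).

Lemma is_wirtinger_eq (F : C -> C) z (a b a' b' : C) : a = a' -> b = b' ->
  is_wirtinger F z a b -> is_wirtinger F z a' b'.
Proof. by move=> -> ->. Qed.

Lemma mul_conj z : z * cj z = (cabs z ^+ 2)%:C.
Proof.
rewrite cabs_sqr; case: z => x y; apply/eqP; rewrite eq_complex /=.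
by apply/andP; split; apply/eqP; ring.
Qed.

Lemma disk_sqr z : D z -> 0 < 1 - cabs z ^+ 2.
Proof. by move=> Dz; rewrite subr_gt0 expr_lt1 ?cabs_ge0. Qed.

Lemma one_sub_mul_conj z : 1 - z * cj z = (1 - cabs z ^+ 2)%:C.
Proof. by rewrite mul_conj [RHS]raddfB. Qed.

Lemma hyp_density_gt0 z : D z -> 0 < hyp_density z.
Proof. by move=> Dz; rewrite divr_gt0// disk_sqr. Qed.

Lemma hyp_densityC z : (hyp_density z)%:C = 2 * (1 - z * cj z)^-1.
Proof.
by rewrite one_sub_mul_conj /hyp_density rmorphM fmorphV rmorph_nat.
Qed.

Lemma inv_hyp_densityC z : ((hyp_density z)^-1)%:C = (1 - z * cj z) / 2.
Proof.
by rewrite one_sub_mul_conj /hyp_density invf_div rmorphM fmorphV rmorph_nat.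
Qed.

(** The [z]-derivative of the logarithm of the hyperbolic density. *)
Definition ln_hyp_dz z : C := cj z * (1 - z * cj z)^-1.

Lemma one_sub_neq0 z : D z -> 1 - z * cj z != 0.
Proof. by move=> Dz; rewrite one_sub_mul_conj -cabs_gt0 cabs_real normr_gt0 gt_eqF// disk_sqr. Qed.

Lemma is_wirtinger_one_sub k z d : is_cderive k z d ->
  is_wirtinger (fun w => 1 - k w * cj (k w)) z (- (d * cj (k z))) (- (k z * cj d)).
Proof.
move=> /is_wirtinger_holo Hk; have Hc := is_wirtinger_conj Hk.
have := is_wirtingerB (is_wirtinger_cst 1 z) (is_wirtingerM Hk Hc).
have cj0 : cj 0 = 0 by rewrite /= oppr0.
by rewrite cj0 mulr0 addr0 mul0r !sub0r add0r.
Qed.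

Lemma is_wirtinger_ln_hyp k z d : D (k z) -> is_cderive k z d ->
  is_wirtinger (fun w => (ln (hyp_density (k w)))%:C) z
    (d * ln_hyp_dz (k z)) (cj (d * ln_hyp_dz (k z))).
Proof.
move=> Dk Hk; have n0 := one_sub_neq0 Dk.
have H := is_wirtingerZ 2 (is_wirtingerV (is_wirtinger_one_sub Hk) n0).
have {}H : is_wirtinger (fun w => (hyp_density (k w))%:C) z
    (2 * (d * cj (k z) / (1 - k z * cj (k z)) ^+ 2))
    (2 * (k z * cj d / (1 - k z * cj (k z)) ^+ 2)).
  rewrite !opprK in H; apply: is_wirtinger_near H.
  by apply: filterE => w; rewrite hyp_densityC.
apply: is_wirtinger_eq (is_wirtinger_real H (is_derive1_ln (hyp_density_gt0 Dk))).
  rewrite inv_hyp_densityC /ln_hyp_dz.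
  by field.
rewrite inv_hyp_densityC /ln_hyp_dz !conjM conjcK.
have -> : cj (1 - k z * cj (k z))^-1 = (1 - k z * cj (k z))^-1.
  by rewrite one_sub_mul_conj -fmorphV; exact: conjc_real.
by field.
Qed.

(** For [k = id] the [z]-derivative is the square of the function. This equation
    [sigma_zz = sigma_z^2] makes the hyperbolic terms drop out of the tensor. *)
Lemma is_wirtinger_ln_hyp_dz k z d : D (k z) -> is_cderive k z d ->
  is_wirtinger (fun w => ln_hyp_dz (k w)) z (d * ln_hyp_dz (k z) ^+ 2)
    (cj d * (1 - k z * cj (k z))^-1 ^+ 2).
Proof.
move=> Dk Hk; have n0 := one_sub_neq0 Dk.
have Hc := is_wirtinger_conj (is_wirtinger_holo Hk).
have cj0 : cj 0 = 0 by rewrite /= oppr0.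
apply: is_wirtinger_eq (is_wirtingerM Hc (is_wirtingerV (is_wirtinger_one_sub Hk) n0)).
  by rewrite cj0 /ln_hyp_dz; field.
by field.
Qed.

(** From [ln |g| = ln (g conj(g)) / 2]. *)
Lemma is_wirtinger_ln_cabs g z d : g z != 0 -> is_cderive g z d ->
  is_wirtinger (fun w => (ln (cabs (g w)))%:C) z (d / (2 * g z)) (cj (d / (2 * g z))).
Proof.
move=> gz Hg; have Hh := is_wirtinger_holo Hg; have Hc := is_wirtinger_conj Hh.
have cj0 : cj 0 = 0 by rewrite /= oppr0.
have H : is_wirtinger (fun w => (cabs (g w) ^+ 2)%:C) z (d * cj (g z)) (g z * cj d).
  have H := is_wirtingerM Hh Hc; rewrite cj0 mulr0 mul0r addr0 add0r in H.
  by apply: is_wirtinger_near H; apply: filterE => w; rewrite mul_conj.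
have c0 : 0 < cabs (g z) ^+ 2 by rewrite exprn_gt0// cabs_gt0.
have cg0 : cj (g z) != 0.
  by rewrite -cabs_gt0 cabs_conj cabs_gt0.
have iC : ((cabs (g z) ^+ 2)^-1)%:C = (g z * cj (g z))^-1 by rewrite mul_conj fmorphV.
have K := is_wirtingerZ (1 / 2) (is_wirtinger_real H (is_derive1_ln c0)).
have {}K := is_wirtinger_near _ K.
apply: is_wirtinger_eq (K _ _).
- by rewrite iC; field; rewrite gz.
- rewrite iC.
  have -> : cj (d / (2 * g z)) = cj d / (2 * cj (g z)).
    rewrite conjM; congr (_ * _); rewrite [LHS]conjc_inv conjM; congr ((_ * _)^-1).
    exact: conjc_nat.
  by field; rewrite ?gz ?cg0.
- apply: filterE => w.
  have [->|gw] := eqVneq (g w) 0.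
    by rewrite cabs0 expr0n /= !ln0 ?lexx// mulr0.
  rewrite lnXn ?cabs_gt0// mulr2n.
  by rewrite raddfD /=; field.
Qed.

(** The terms of the hyperbolic density cancel by [is_wirtinger_ln_hyp_dz]. *)
Lemma schwarzian_tensor_hyp (rho : C -> R) (A : C -> C) (B : C -> C) z (A' B' : C) : D z ->
  (\forall w \near z, is_wirtinger (fun v => (ln (rho v))%:C) w (A w) (B w)) ->
  is_wirtinger A z A' B' -> schwarzian_tensor (@hyp_density R) rho z = A' - A z ^+ 2.
Proof.
move=> Dz H HA; rewrite /schwarzian_tensor.
have Dn : \forall w \near z, D w.
  apply/nbhs_cabsP; exists (1 - cabs z); first by rewrite subr_gt0.
  move=> w wz; rewrite /disk /=.
  have -> : w = (w - z) + z by rewrite subrK.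
  by apply: (le_lt_trans (ler_cabsD _ _)); move: wz; lra.
set s1 := fun w : C => (ln (hyp_density w))%:C : C.
set s2 := fun w : C => (ln (rho w))%:C : C.
have H1 w : D w -> is_wirtinger s1 w (ln_hyp_dz w) (cj (ln_hyp_dz w)).
  by move=> Dw; have := is_wirtinger_ln_hyp Dw (is_cderive_id w); rewrite mul1r.
have K : is_wirtinger (wirtinger (fun w => s2 w - s1 w)) z
    (A' - 1 * ln_hyp_dz z ^+ 2) (B' - cj 1 * (1 - z * cj z)^-1 ^+ 2).
  apply: is_wirtinger_near (is_wirtingerB HA (is_wirtinger_ln_hyp_dz Dz (is_cderive_id z))).
  apply: filterS2 Dn H => w Dw Hw.
  by rewrite (is_wirtinger_wirtinger (is_wirtingerB Hw (H1 w Dw))).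
rewrite (is_wirtinger_wirtinger K) (is_wirtinger_wirtinger (nbhs_singleton H)).
rewrite (is_wirtinger_wirtinger (H1 z Dz)); ring.
Qed.

(** Here [s = ln |g|], so [s_z = g' / (2 g)]: the tensor is half of the Schwarzian
    derivative of a primitive of [g]. *)
Lemma tensor_euclidean (rho : C -> R) g g' (g2 : C) z : D z -> g z != 0 ->
  (\forall w \near z, rho w = cabs (g w)) ->
  (\forall w \near z, is_cderive g w (g' w)) -> is_cderive g' z g2 ->
  schwarzian_tensor (@hyp_density R) rho z = schwarz_of_jet (g z) (g' z) g2 / 2.
Proof.
move=> Dz gz Hrho Hg Hg'.
have gn : \forall w \near z, g w != 0.
  by apply: continuous_neq0 => //; exact: is_cderive_continuous (nbhs_singleton Hg).
have z2 : 2 * g z != 0 by rewrite mulf_neq0// pnatr_eq0.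
rewrite (@schwarzian_tensor_hyp rho (fun w => g' w / (2 * g w)) (fun w => cj (g' w / (2 * g w)))
  z (g2 * (2 * g z)^-1 + g' z * (- (2 * g' z) / (2 * g z) ^+ 2)) 0) //.
- rewrite /schwarz_of_jet; by field.
- apply: filterS3 (near_near Hrho) gn Hg => w Hw gw Hgw.
  apply: is_wirtinger_near (is_wirtinger_ln_cabs gw Hgw).
  by apply: filterS Hw => v ->.
- apply: is_wirtinger_holo.
  exact: (is_cderiveM Hg' (@is_cderiveV _ (fun w => 2 * g w) z _ z2 (is_cderiveZ 2 (nbhs_singleton Hg)))).
Qed.

(** Here [s_z = k' h(k) + k'' / (2 k')], with [h] the derivative [ln_hyp_dz]. Since
    [h_z = h^2], the terms with [h] cancel in [s_zz - s_z^2]. *)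
Lemma tensor_hyperbolic (rho : C -> R) k k' k2 (k3 : C) z : D z ->
  (\forall w \near z, D (k w)) -> k' z != 0 ->
  (\forall w \near z, rho w = hyp_density (k w) * cabs (k' w)) ->
  (\forall w \near z, is_cderive k w (k' w)) ->
  (\forall w \near z, is_cderive k' w (k2 w)) -> is_cderive k2 z k3 ->
  schwarzian_tensor (@hyp_density R) rho z = schwarz_of_jet (k' z) (k2 z) k3 / 2.
Proof.
move=> Dz Dk kz Hrho H1 H2 H3.
have kn : \forall w \near z, k' w != 0.
  by apply: continuous_neq0 => //; exact: is_cderive_continuous (nbhs_singleton H2).
have z2 : 2 * k' z != 0 by rewrite mulf_neq0// pnatr_eq0.
have Dkz := nbhs_singleton Dk.
have Hk := nbhs_singleton H1.
have T1 := is_wirtingerM (is_wirtinger_holo (nbhs_singleton H2)) (is_wirtinger_ln_hyp_dz Dkz Hk).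
have T2 := is_wirtinger_holo (is_cderiveM H3 (@is_cderiveV _ (fun w => 2 * k' w) z _ z2 (is_cderiveZ 2 (nbhs_singleton H2)))).
rewrite (schwarzian_tensor_hyp (B := fun w => cj (k' w * ln_hyp_dz (k w)) + cj (k2 w / (2 * k' w)))
  Dz _ (is_wirtingerD T1 T2)).
- rewrite /schwarz_of_jet; move: (ln_hyp_dz (k z)) => h; by field.
- near=> w.
  have Dw : D (k w) by near: w.
  have kw : k' w != 0 by near: w.
  have H1w : is_cderive k w (k' w) by near: w.
  have H2w : is_cderive k' w (k2 w) by near: w.
  have Hw : \forall v \near w, rho v = hyp_density (k v) * cabs (k' v).
    by near: w; exact: near_near.
  have Dv : \forall v \near w, D (k v) by near: w; exact: near_near.
  have nv : \forall v \near w, k' v != 0 by near: w; exact: near_near.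
  apply: is_wirtinger_near (is_wirtingerD (is_wirtinger_ln_hyp Dw H1w) (is_wirtinger_ln_cabs kw H2w)).
  apply: filterS3 Hw Dv nv => v -> Dkv nkv.
  by rewrite lnM ?posrE ?cabs_gt0 ?hyp_density_gt0// raddfD.
Unshelve. all: by end_near.
Qed.

(** For [dk = a dz + b d(conj z)], the (2,0) part of [|dk|^2] is
    [a conj(b) dz^2]. *)
Lemma hopf_wirtinger k z (a b : C) : is_wirtinger k z a b ->
  hopf_differential k z = (hyp_density (k z) ^+ 2)%:C * (a * cj b).
Proof.
move=> H; rewrite /hopf_differential (is_wirtinger_dx H) (is_wirtinger_dy H) /part20.
move: (hyp_density _ ^+ 2) => r; rewrite !cabs_sqr.
case: a b {H} => [a1 a2] [b1 b2]; apply/eqP; rewrite eq_complex /=.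
by apply/andP; split; apply/eqP; field.
Qed.

Lemma hopf_conformal k z d : is_cderive k z d -> hopf_differential k z = 0.
Proof.
move=> /is_wirtinger_holo/hopf_wirtinger ->.
have -> : cj 0 = 0 by rewrite /= oppr0.
by rewrite !mulr0.
Qed.

(** Near [z] the map [k] is [B (i e^(Re W))], with [B] the inverse of [A]. Its two
    Wirtinger derivatives are [B' y g / 2] and [B' y conj(g) / 2], with
    [y = i e^(Re W)], so the Hopf differential is [g^2 / 4] times the square of
    [|B'| |y|] in the hyperbolic metric. That factor is [1] because [B] is an
    isometry and [|y|] is the height of [y]. *)
Lemma hopf_strip (M : 'M[C]_2) (A : C -> C) k W (g : C) z :
  M \in unitmx -> (forall z, D z -> mobius M z = Some (A z)) -> A @` D = @halfplane R ->
  (\forall w \near z, D (k w) /\ A (k w) = (0 +i* expR (complex.Re (W w)))) ->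
  is_cderive W z g -> hopf_differential k z = g ^+ 2 / 4.
Proof.
move=> uM HM AH Hk HW.
have [HA [S [S0 HS HI]]] := disk_to_halfplane uM HM AH.
have := det2_unit uM.
move: (M ord0 ord0) (M ord0 ord_max) (M ord_max ord0) (M ord_max ord_max) HA HS HI.
move=> a b c d HA HS HI det0.
pose i : C := (0 +i* 1).
pose y w : C := i * cexp (1 / 2 * (W w + cj (W w))).
have yE w : y w = (0 +i* expR (complex.Re (W w))).
  rewrite /y /i; have -> : 1 / 2 * (W w + cj (W w)) = (complex.Re (W w))%:C.
    by case: (W w) => p q; apply/eqP; rewrite eq_complex /=; apply/andP; split; apply/eqP; field.
  by rewrite /cexp /= cos0 sin0; apply/eqP; rewrite eq_complex /=; apply/andP; split; apply/eqP; ring.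
have cj0 : cj 0 = 0 by rewrite /= oppr0.
have Hh := is_wirtinger_holo HW.
have Hre := is_wirtingerZ (1 / 2) (is_wirtingerD Hh (is_wirtinger_conj Hh)).
have Hy : is_wirtinger y z (y z * (g / 2)) (y z * (cj g / 2)).
  apply: is_wirtinger_eq (is_wirtingerZ i (is_wirtinger_comp Hre (is_cderive_cexp _))).
    by rewrite /y cj0 addr0; field.
  by rewrite /y add0r; field.
have den w : D w -> a - c * A w = (a * d - b * c) / (c * w + d).
  by move=> /HA[L0 ->]; field.
have num w : D w -> d * A w - b = (a * d - b * c) * w / (c * w + d).
  by move=> /HA[L0 ->]; field.
have [Dk Ak] := nbhs_singleton Hk.
have [Lz _] := HA _ Dk.
have nz : a - c * y z != 0.
  by rewrite yE -Ak den// mulf_neq0// invr_neq0.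
pose B v := (d * v - b) / (a - c * v).
have HB : is_cderive B (y z) ((a * d - b * c) / (a - c * y z) ^+ 2).
  have N := is_cderiveB (is_cderiveZ d (is_cderive_id (y z))) (is_cderive_cst b _).
  have E := is_cderiveB (is_cderive_cst a _) (is_cderiveZ c (is_cderive_id (y z))).
  apply: is_cderive_eq (is_cderiveM N (@is_cderiveV _ (fun v => a - c * v) (y z) _ nz E)).
  by field.
have HBy := @is_wirtinger_comp _ y B z _ _ _ Hy HB.
rewrite (hopf_wirtinger (is_wirtinger_near _ HBy)); last first.
  apply: filterS Hk => w [Dw Aw]; rewrite /B yE -Aw den// num//.
  by have [Lw _] := HA _ Dw; field; rewrite det0 Lw.
set q := _ / _ ^+ 2.
have -> : (q * (y z * (g / 2))) * cj (q * (y z * (cj g / 2))) =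
    (q * cj q) * (y z * cj (y z)) * (g ^+ 2 / 4).
  rewrite (conjM q) (conjM (y z)) (conjM (cj g)) conjcK.
  have -> : cj (2^-1) = 2^-1 :> C.
    by rewrite [LHS]conjc_inv; congr (_^-1); exact: conjc_nat.
  by move: (cj q) (cj (y z)) (y z) => q' y' yz; field.
rewrite !mul_conj -!rmorphM /= mulrA -[X in X * _]rmorphM.
have -> : hyp_density (k z) ^+ 2 * (cabs q ^+ 2 * cabs (y z) ^+ 2) = 1; last by rewrite mul1r.
rewrite -!exprMn; apply/eqP; rewrite sqrf_eq1; apply/orP; left; apply/eqP.
have yI : cabs (y z) = complex.Im (A (k z)).
  by rewrite yE Ak /= expr0n add0r sqrtr_sqr ger0_norm// expR_ge0.
have -> : q = (c * k z + d) ^+ 2 / (a * d - b * c).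
  by rewrite /q yE -Ak den//; field; rewrite det0 Lz.
rewrite yI cabsM cabsV HS expr2 cabsM -expr2.
have := HI _ Dk; have := disk_sqr Dk; rewrite /hyp_density.
move: (1 - _) => u u0 Hu.
have -> : 2 / u * (cabs (c * k z + d) ^+ 2 / (2 * S) * complex.Im (A (k z))) =
  (complex.Im (A (k z)) * cabs (c * k z + d) ^+ 2) / (S * u).
  by field; rewrite !gt_eqF.
by rewrite Hu divff// mulf_neq0// gt_eqF.
Qed.

End Densities.

(** * The grafted surface *)

Section Assembly.
Variables (R : realType) (pi : groupType).
Local Notation C := (cplx R).
Local Notation D := (@disk R).
Local Notation mu2 := ((@lebesgue_measure R) \x (@lebesgue_measure R))%E.

Lemma conformal_jet (O : set C) (g : C -> C) z : open O -> conformal_on O g -> O z ->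
  exists g1 g2 g3 : C -> C, [/\ g1 z != 0 /\ forall w, derive1 g w = g1 w,
    \forall w \near z, is_cderive g w (g1 w),
    \forall w \near z, is_cderive g1 w (g2 w) & \forall w \near z, is_cderive g2 w (g3 w)].
Proof.
move=> oO cO Oz.
have nO : nbhs z O by apply: open_nbhs_nbhs.
have H1 : \forall w \near z, is_cderive g w (derive1 g w).
  by apply: filterS nO => w /cO[dg _]; apply/is_cderiveP.
have H2 := holomorphic_deriv H1.
do 3 eexists.
exact: (And4 (conj (cO z Oz).2 (fun w => erefl _)) H1 H2 (holomorphic_deriv H2)).
Qed.

Variables (X Y : pi -> C -> C) (lam : weighted_curves R pi)
  (Psi : C -> C * R) (f : C -> option C) (rho : C -> R).
Hypotheses (mY : marked_surface Y) (uPsi : graft_uniformization Y lam X Psi)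
  (df : developing_map Y lam Psi f) (tm : thurston_metric Y lam Psi rho).

Let holds (z : C) : Prop := 2 * schwarzian f z =
  4 * schwarzian_tensor (@hyp_density R) rho z - grafting_differential Psi z.

Let Psi_cover z : D z -> graft_cover Y lam (Psi z).
Proof. by move=> Dz; have [[fPsi _ _] _ _] := uPsi; exact: fPsi. Qed.

(** [kappa] itself is a chart here, with the developing map [M o kappa]. *)
Lemma outside_strips z : D z -> ~ lam_support Y lam (Psi z).1 -> holds z.
Proof.
move=> Dz nz; have [_ _ /(_ _ _ _ (complement_chart Y lam))[oO cO]] := uPsi.
set O := D `&` _ in oO cO.
have Oz : O z by split => //; split => //; exact: Psi_cover.
have nO : nbhs z O by apply: open_nbhs_nbhs.
have [k1 [k2 [k3 [[k0 dk] H1 H2 H3]]]] := conformal_jet oO cO Oz.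
pose k : C -> C := fun w => (Psi w).1.
have [M uM HM] := df Dz (complement_chart Y lam) Oz.2.
rewrite /holds (schwarzian_mobius uM HM k0 H1 H2 (nbhs_singleton H3)).
have Dk : \forall w \near z, D (k w) by apply: filterS nO => w [_ [[]]].
have Hrho : \forall w \near z, rho w = hyp_density (k w) * cabs (k1 w).
  by apply: filterS nO => w [Dw [_ nw]]; rewrite ((tm Dw).1 nw) dk.
rewrite (tensor_hyperbolic Dz Dk k0 Hrho H1 H2 (nbhs_singleton H3)).
rewrite /grafting_differential (hopf_conformal (nbhs_singleton H1)).
by field.
Qed.

(** On the axis the argument is [pi / 2], so the logarithmic coordinate records the
    position on the geodesic and the height in the strip. *)
Lemma log_chart_axis i a A w : normalizes Y (curve lam i ^ a)%g A ->
  lam_lift Y i a (Psi w).1 ->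
  A (Psi w).1 = (0 +i* expR (complex.Re (log_chart A (weight lam i) (Psi w)))) /\
  complex.Im (log_chart A (weight lam i) (Psi w)) = trigo.pi / 2 + (Psi w).2.
Proof.
move=> nA ax; have [Dw _] := ax.
have [hY _ _ _] := mY; have [_ hD] := hY (curve lam i ^ a)%g.
have Re0 := axis_normalizes hD nA ax.
have [[M uM HM] AH _] := nA.
have Ipos : 0 < complex.Im (A (Psi w).1).
  by have : (A @` D) (A (Psi w).1) by [exists (Psi w).1]; rewrite AH.
rewrite /log_chart /= Re0 ltxx mul0r acos0 addr0; split => //.
case: (A (Psi w).1) Re0 Ipos => x y /= -> y0.
by rewrite expr0n add0r sqrtr_sqr gtr0_norm// lnK.
Qed.

(** The chart leaves the strip [pi / 2 < arg < pi / 2 + t] free for the inserted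
    points. So the imaginary part of a logarithmic coordinate tells whether a
    point is inside the strip, and the inside is open. *)
Lemma log_chart_outside i a A w : normalizes Y (curve lam i ^ a)%g A ->
  D w -> ~ lam_support Y lam (Psi w).1 ->
  let y := complex.Im (log_chart A (weight lam i) (Psi w)) in
  y <= trigo.pi / 2 \/ trigo.pi / 2 + weight lam i < y.
Proof.
move=> nA Dw nw.
have [Dk [[_ s0]|[j [b [ax _]]]]] := Psi_cover Dw; last first.
  by case: nw; exists j, b.
have [_ AH _] := nA.
have : (A @` D) (A (Psi w).1) by exists (Psi w).1.
rewrite AH /log_chart s0 addr0 /halfplane /=; case: (A _) => x y /= y0.
set m := Num.sqrt _.
have m0 : 0 < m by rewrite sqrtr_gt0 ltr_wpDl ?sqr_ge0// exprn_gt0.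
have xm : -1 <= x / m <= 1.
  have := Re_le_cabs (x +i* y : C); rewrite /= -/m ler_norml => /andP[h1 h2].
  by rewrite ler_pdivlMr// ler_pdivrMr// mulN1r mul1r h1.
have cosx : cos (acos (x / m)) = x / m.
  by rewrite acosK// in_itv.
have := acos_ge0 xm; have := acos_lepi xm => ap a0.
case: ltrP => x0; [right|left; rewrite addr0].
  rewrite ltrD2r ltNge; apply/negP => h.
  have : 0 <= cos (acos (x / m)).
    by apply: cos_ge0_pihalf; rewrite h andbT (le_trans _ a0)// oppr_le0 divr_ge0// pi_ge0.
  by rewrite cosx leNgt pmulr_llt0 ?invr_gt0// x0.
rewrite leNgt; apply/negP => h.
have : cos (acos (x / m)) < 0.
  have -> : acos (x / m) = (acos (x / m) - trigo.pi) + trigo.pi by rewrite subrK.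
  rewrite cosDpi oppr_lt0; apply: cos_gt0_pihalf; lra.
by rewrite cosx ltNge divr_ge0// ltW.
Qed.

(** The coordinate [W] is valid near [z], where all the points are in the strip by
    [log_chart_outside]. The developing map is [M o exp W]. *)
Lemma inside_strip z i a : D z -> lam_lift Y i a (Psi z).1 ->
  0 < (Psi z).2 < weight lam i -> holds z.
Proof.
move=> Dz ax sz; have [Dkz [A nA _]] := ax.
set t := weight lam i in sz *.
have [_ _ /(_ _ _ _ (cylinder_chart nA))[oO cO]] := uPsi.
set O := D `&` _ in oO cO.
have Oz : O z by split => //; split => //; exact: Psi_cover.
have nO : nbhs z O by apply: open_nbhs_nbhs.
have [g [g1 [g2 [[g0 dg] H1 H2 H3]]]] := conformal_jet oO cO Oz.
pose W : C -> C := log_chart A t \o Psi.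
have [M uM HM] := df Dz (cylinder_chart nA) Oz.2.
have strip : \forall w \near z, O w /\ lam_lift Y i a (Psi w).1.
  have cW0 : {for z, continuous W} := is_cderive_continuous (nbhs_singleton H1).
  have /continuous_cabsP cW := cW0.
  have ImW : complex.Im (W z) = trigo.pi / 2 + (Psi z).2 := (log_chart_axis nA ax).2.
  pose e := Order.min (Psi z).2 (t - (Psi z).2).
  have e0 : 0 < e by rewrite lt_min; case/andP: sz => s0 st; rewrite s0 subr_gt0.
  have [d d0 Hd] := cW e e0.
  have nd : \forall w \near z, cabs (w - z) < d by apply/nbhs_cabsP; exists d.
  apply: filterS2 nO nd => w Ow /Hd wd; split => //; apply: (Ow.2.2).
  apply/not_notP => nw.
  have Q : complex.Im (W w) <= trigo.pi / 2 \/ trigo.pi / 2 + t < complex.Im (W w) :=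
    log_chart_outside nA Ow.1 nw.
  have E : complex.Im (W w - W z) = complex.Im (W w) - complex.Im (W z) by exact: raddfB.
  have := le_lt_trans (Im_le_cabs _) wd; rewrite E ImW lt_min !ltr_norml.
  by move=> /andP[/andP[h1 h2] /andP[h3 h4]]; case: Q; lra.
have Hrho : \forall w \near z, rho w = cabs (g w).
  by apply: filterS strip => w [[Dw _] aw]; rewrite ((tm Dw).2 i a A nA aw) dg.
have [[N uN HN] AH _] := nA.
have Hk : \forall w \near z, D (collapsing_map Psi w) /\
    A (collapsing_map Psi w) = (0 +i* expR (complex.Re (W w))).
  apply: filterS strip => w [Ow aw]; split; first by have [] := aw.
  exact: (log_chart_axis nA aw).1.
rewrite /holds /grafting_differential (hopf_strip uN HN AH Hk (nbhs_singleton H1)).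
rewrite (tensor_euclidean Dz g0 Hrho H2 (nbhs_singleton H3)).
pose E w := cexp (W w).
have HE w : is_cderive W w (g w) -> is_cderive E w (E w * g w).
  by move=> Hw; exact: (is_cderive_comp Hw (is_cderive_cexp (W w))).
have K1 : \forall w \near z, is_cderive E w (E w * g w).
  by apply: filterS H1 => w; exact: HE.
have K2 : \forall w \near z, is_cderive (fun w => E w * g w) w (E w * (g w * g w + g1 w)).
  apply: filterS2 K1 H2 => w Ew gw.
  by apply: is_cderive_eq (is_cderiveM Ew gw); ring.
have K3 : is_cderive (fun w => E w * (g w * g w + g1 w)) z
    (E z * (g z ^+ 3 + 3 * g z * g1 z + g2 z)).
  have G := nbhs_singleton H2; have G1 := nbhs_singleton H3.
  apply: is_cderive_eq (is_cderiveM (nbhs_singleton K1) (is_cderiveD (is_cderiveM G G) G1)).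
  by ring.
have E0 : E z != 0 := cexp_neq0 _.
have Eg0 : E z * g z != 0 by rewrite mulf_neq0.
rewrite (@schwarzian_mobius _ M f E (fun w => E w * g w) (fun w => E w * (g w * g w + g1 w)) _ z
  uM HM Eg0 K1 K2 K3).
by rewrite /schwarz_of_jet; field; rewrite g0 E0.
Qed.

(** A point where the equality fails has its image on the boundary of a strip. The
    chart of that strip sends the nearby points of this kind to the lines of
    height [pi / 2] or [pi / 2 + t], with [t] one of the weights. *)
Lemma ae_holds : qd_eq_ae (fun z => 2 * schwarzian f z)
    (fun z => 4 * schwarzian_tensor (@hyp_density R) rho z - grafting_differential Psi z).
Proof.
pose pt (p : R * R) : C := p.1 +i* p.2.
pose B : set (R * R) := [set p | D (pt p) /\ ~ holds (pt p)].
have BN : mu2.-negligible B; last first.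
  by apply: negligible2S BN => p /=; move=> /not_implyP[Dp np]; split.
apply: locally_negligible => p [Dp np].
have nbox (O : set C) : nbhs (pt p) O -> exists2 e, 0 < e & forall q, box p e q -> O (pt q).
  move=> /nbhs_cabsP[e e0 He]; exists (e / 2); first by rewrite divr_gt0.
  move=> q [q1 q2]; apply: He; rewrite (splitr e).
  by apply: (le_lt_trans (cabs_le_ReIm _)); exact: ltrD.
have [[i [a ax]]|ns] := pselect (lam_support Y lam (Psi (pt p)).1); last first.
  by case: np; exact: outside_strips.
have [Dk [A nA _]] := ax.
have [_ _ /(_ _ _ _ (cylinder_chart nA))[oO cO]] := uPsi.
set O := D `&` _ in oO cO.
have Op : O (pt p) by split => //; split => //; exact: Psi_cover.
have nO : nbhs (pt p) O by apply: open_nbhs_nbhs.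
have [g1 [g2 [_ [[g0 _] H1 H2 _]]]] := conformal_jet oO cO Op.
pose W : C -> C := log_chart A (weight lam i) \o Psi.
have cg := is_cderive_continuous (nbhs_singleton H2).
have [e1 e10 L] := level_negligible H1 cg g0.
have [e2 e20 HO] := nbox O nO.
pose level (t : R) : set (R * R) := [set q | box p e1 q /\ complex.Im (W (pt q)) = trigo.pi / 2 + t].
(* Indexed by nat, and empty beyond the curves, to use a countable union. *)
pose N (n : nat) : set (R * R) := if insub n is Some j then level (weight lam j) else set0.
have NN : mu2.-negligible (level 0 `|` \bigcup_n N n).
  apply: (@negligibleU _ _ _ mu2); first exact: L.
  apply: (@negligible_bigcup _ _ _ mu2) => n; rewrite /N.
  by case: insubP => [j _ _|_]; [exact: L|exact: (@negligible_set0 _ _ _ mu2)].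
exists (Order.min e1 e2); first by rewrite lt_min e10.
apply: negligible2S NN => q [[Dq nq] [/=]]; rewrite !lt_min => /andP[q1 q1'] /andP[q2 q2'].
have bq : box p e1 q by [].
have Oq := HO q (conj q1' q2').
have sq : lam_support Y lam (Psi (pt q)).1.
  by apply/not_notP => ns; apply: nq; exact: outside_strips.
have axq : lam_lift Y i a (Psi (pt q)).1 by apply: Oq.2.2.
have ImW : complex.Im (W (pt q)) = trigo.pi / 2 + (Psi (pt q)).2 := (log_chart_axis nA axq).2.
have [_ [[ns _]//|[j [b [axj /andP[s0 st]]]]]] := Psi_cover Dq.
have [s_eq|s_ne] := eqVneq (Psi (pt q)).2 0.
  by left; split => //; rewrite ImW s_eq.
have [t_eq|t_ne] := eqVneq (Psi (pt q)).2 (weight lam j).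
  right; exists (j : nat) => //; rewrite /N valK; split => //.
  by rewrite ImW t_eq.
case: nq; apply: (inside_strip Dq axj).
by rewrite !lt_neqAle s0 st eq_sym s_ne t_ne.
Qed.

End Assembly.

Theorem theorem7p1 (R : realType) (g : nat) (pi : groupType)
    (X Y : pi -> cplx R -> cplx R) (lam : weighted_curves R pi)
    (Psi : cplx R -> cplx R * R) (f : cplx R -> option (cplx R))
    (rho : cplx R -> R) :
  (2 <= g)%N -> surface_group g pi ->
  marked_surface X -> marked_surface Y ->
  multicurve_on Y lam ->
  graft_uniformization Y lam X Psi ->
  developing_map Y lam Psi f ->
  thurston_metric Y lam Psi rho ->
  qd_eq_ae (fun z => 2 * schwarzian f z)
    (fun z => 4 * schwarzian_tensor (@hyp_density R) rho z
              - grafting_differential Psi z).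
Proof.
by move=> _ _ _ mY _ uPsi df tm; exact: (ae_holds mY uPsi df tm).
Qed.
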